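(* Suppose that the reduced order system (ROS) and the boundary-layer system (BLS) are exponentially stable. Then there exists $\varepsilon_\ast > 0$ such that the full system (FULL) with parameter $\varepsilon$ is exponentially stable for every $\varepsilon \in (0, \varepsilon_\ast]$.
   Context: Data: positive integers $n, m$; a diagonal matrix $\Lambda \in \mathbb{R}^{m\times m}$ with positive diagonal entries $\lambda_1,\dots,\lambda_m$; real matrices $A \in \mathbb{R}^{n\times n}$, $B \in \mathbb{R}^{n\times m}$, $G_1 \in \mathbb{R}^{m\times m}$, $G_2 \in \mathbb{R}^{m\times n}$, with $I_m - G_1$ invertible; a parameter $\varepsilon > 0$. (FULL) is the system with unknowns $z\colon[0,\infty)\to\mathbb{R}^n$ and $y\colon[0,1]\times[0,\infty)\to\mathbb{R}^m$: $$\dot z(t) = A z(t) + B y(1,t),\ t>0;\qquad \varepsilon y_t(x,t) + \Lambda y_x(x,t) = 0,\ x\in(0,1),\ t>0;$$ $$y(0,t) = G_1 y(1,t) + G_2 z(t),\ t>0;\qquad z(0)=z_0;\qquad y(x,0)=y_0(x),\ x\in(0,1).$$ (ROS) is the linear ODE $\dot{\bar z}(t) = (A + B(I_m-G_1)^{-1}G_2)\bar z(t)$, $t>0$, $\bar z(0)=z_0$. (BLS) is the system with unknown $\bar y\colon[0,1]\times[0,\infty)\to\mathbb{R}^m$: $\bar y_\tau(x,\tau)+\Lambda \bar y_x(x,\tau)=0$ for $x\in(0,1)$, $\tau>0$; $\bar y(0,\tau)=G_1\bar y(1,\tau)$ for $\tau>0$; with a prescribed initial condition $\bar y(\cdot,0)$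 (namely $\bar y(x,0) = y_0(x)-(I_m-G_1)^{-1}G_2z_0$). Solutions: solutions of the transport equations are understood in the weak sense, equivalently through the method of characteristics. For (FULL) this means: for each component $i$, $y_i(x,t) = y_i(0, t - \varepsilon x/\lambda_i)$ if $t \ge \varepsilon x/\lambda_i$ and $y_i(x,t) = (y_0)_i(x - \lambda_i t/\varepsilon)$ otherwise, together with the boundary condition and the ODE (in integral form); for (BLS) the same with $\varepsilon = 1$, no $z$, and boundary condition $\bar y(0,\tau)=G_1\bar y(1,\tau)$. With this notion the systems are well-posed for initial data in $\mathbb{R}^n\times\mathcal B$ (resp. $\mathcal B$), where $\mathcal B$ is any of the spaces $L^p(0,1;\mathbb{R}^m)$, $p\in[1,\infty]$, or $C^0([0,1];\mathbb{R}^m)$ with the sup norm; in the $C^0$ case initial data are required to satisfy the compatibility condition $y_0(0)=G_1y_0(1)+G_2z_0$ for (FULL), resp. $\bar y(0,0)=G_1\bar y(1,0)$ for (BLS). Exponential stability: (ROS) is exponentially stable if there are $C,\nu>0$ with $|\bar z(t)|\le Ce^{-\nu t}|\bar z(0)|$ for all solutions and all $t\ge0$. (FULL) is exponentially stable in $\mathbb{R}^n\times\mathcal B$ if there are $C,\nu>0$ such that all solutions with initial data $z_0\in\mathbb{R}^n$, $y_0\in\mathcal B$ satisfy $|z(t)|+\|y(\cdot,t)\|_{\mathcal B}\le Ce^{-\nu t}(|z_0|+\|y_0\|_{\mathcal B})$ for all $t\ge0$. (BLS) is exponentially stable in $\mathcal B$ if there are $C,\nu>0$ such that all solutions with initial condition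 in $\mathcal B$ satisfy $\|\bar y(\cdot,t)\|_{\mathcal B}\le Ce^{-\nu t}\|\bar y(\cdot,0)\|_{\mathcal B}$ for all $t\ge0$. For both (FULL) and (BLS) this property is known not to depend on the choice of $\mathcal B$ among the spaces $L^p(0,1;\mathbb{R}^m)$, $p\in[1,\infty]$, and $C^0([0,1];\mathbb{R}^m)$; ''exponentially stable'' without mention of $\mathcal B$ means exponentially stable for some (hence every) such $\mathcal B$. *)

(* Defs.v *)
From HB Require Import structures.
From mathcomp Require Import all_boot all_order all_algebra.
From mathcomp Require Import all_classical all_reals all_analysis.

Set Implicit Arguments.
Unset Strict Implicit.
Unset Printing Implicit Defensive.

Import Order.TTheory GRing.Theory Num.Theory.
Import numFieldNormedType.Exports.

Local Open Scope classical_set_scope.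
Local Open Scope ring_scope.

(* The library norm on matrices is the max norm, hence this definition. *)
Definition enorm (R : realType) (k : nat) (v : 'cV[R]_k) : R :=
  Num.sqrt (\sum_(i < k) v i 0 ^+ 2).

(* The spaces B of initial data: L^p(0,1; R^m) for p in [1, +oo], or
   C^0([0,1]; R^m). *)
Inductive data_space (R : realType) : Type :=
  | Lebesgue_space (p : \bar R) of (1 <= p)%E
  | Continuous_space.
Arguments Continuous_space {R}.

Section DataSpaces.
Variables (R : realType) (m : nat).
Implicit Types (S : data_space R) (f : R -> 'cV[R]_m).

Definition lebesgue01 : {measure set (measurableTypeR R) -> \bar R} :=
  mrestr lebesgue_measure (measurable_itv `]0%R, 1%R[).

(* A function on (0,1) or [0,1] is represented by a function on R, whose values
   outside of the interval play no role. *)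
Definition space_norm S f : \bar R :=
  match S with
  | Lebesgue_space p _ => Lnorm lebesgue01 p (fun x => (enorm (f x))%:E)
  | Continuous_space => ereal_sup [set (enorm (f x))%:E | x in `[0%R, 1%R]]
  end.

(* In the Lebesgue case f is a (Borel) representative of a class in L^p. *)
Definition in_space S f : Prop :=
  match S with
  | Lebesgue_space _ _ =>
      (forall i, measurable_fun (`]0, 1[ : set R) (fun x => f x i 0)) /\
      (space_norm S f < +oo)%E
  | Continuous_space => {within `[0, 1], continuous f}
  end.

End DataSpaces.

(* Solution formula along the characteristics for
     eps y_t + diag_mx lam y_x = 0,   y(., 0) = y0,
   the first argument of y being x. For t = 0 the second branch is the initial
   condition y(x, 0) = y0(x). In the Lebesgue case, imposing the formula (and,
   below, the boundary condition) everywhere rather than almost everywhere only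
   amounts to selecting a representative of the solution. *)
Definition transported (R : realType) (m : nat) (eps : R) (lam : 'rV[R]_m)
    (y0 : R -> 'cV[R]_m) (y : R -> R -> 'cV[R]_m) : Prop :=
  forall (i : 'I_m) (x t : R), 0 <= x <= 1 -> 0 <= t ->
    y x t i 0 = if eps * x / lam 0 i <= t
                then y 0 (t - eps * x / lam 0 i) i 0
                else y0 (x - lam 0 i * t / eps) i 0.

Section Systems.
Variables (R : realType) (n m : nat).
Variables (lam : 'rV[R]_m) (A : 'M[R]_n) (B : 'M[R]_(n, m)).
Variables (G1 : 'M[R]_m) (G2 : 'M[R]_(m, n)).
Implicit Types S : data_space R.

Definition full_data S (z0 : 'cV[R]_n) (y0 : R -> 'cV[R]_m) : Prop :=
  in_space S y0 /\
  match S with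
  | Lebesgue_space _ _ => True
  | Continuous_space => y0 0 = G1 *m y0 1 + G2 *m z0
  end.

(* In the C^0 case, full_in_space at t = 0 also fixes the value y(0, 0), about
   which the characteristics and the boundary condition (t > 0) say nothing. *)
Record full_solution (eps : R) S (z0 : 'cV[R]_n) (y0 : R -> 'cV[R]_m)
    (z : R -> 'cV[R]_n) (y : R -> R -> 'cV[R]_m) : Prop := FullSolution {
  full_integrable : forall (i : 'I_n) (t : R), 0 <= t ->
    lebesgue_measure.-integrable `[0, t]
      (fun s => ((A *m z s + B *m y 1 s) i 0)%:E);
  full_ode : forall (i : 'I_n) (t : R), 0 <= t ->
    z t i 0 = z0 i 0 +
      \int[lebesgue_measure]_(s in `[0, t]) ((A *m z s + B *m y 1 s) i 0);
  full_transport : transported eps lam y0 y;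
  full_boundary : forall t, 0 < t -> y 0 t = G1 *m y 1 t + G2 *m z t;
  full_in_space : forall t, 0 <= t -> in_space S (y ^~ t)
}.

Definition full_exp_stable (eps : R) S : Prop :=
  exists C nu : R, [/\ 0 < C, 0 < nu &
    forall z0 y0 z y, full_data S z0 y0 ->
    full_solution eps S z0 y0 z y ->
    forall t, 0 <= t ->
      ((enorm (z t))%:E + space_norm S (y ^~ t) <=
       (C * expR (- nu * t))%:E * ((enorm z0)%:E + space_norm S y0))%E].

Definition ros_matrix : 'M[R]_n := A + B *m invmx (1%:M - G1) *m G2.

Definition ros_solution (z : R -> 'cV[R]_n) : Prop :=
  {within `[0, +oo[, continuous z} /\
  forall t : R, 0 < t -> is_derive t 1 z (ros_matrix *m z t).

Definition ros_exp_stable : Prop :=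
  exists C nu : R, [/\ 0 < C, 0 < nu &
    forall z, ros_solution z -> forall t, 0 <= t ->
      enorm (z t) <= C * expR (- nu * t) * enorm (z 0)].

Definition bls_data S (y0 : R -> 'cV[R]_m) : Prop :=
  in_space S y0 /\
  match S with
  | Lebesgue_space _ _ => True
  | Continuous_space => y0 0 = G1 *m y0 1
  end.

Record bls_solution S (y0 : R -> 'cV[R]_m)
    (y : R -> R -> 'cV[R]_m) : Prop := BlsSolution {
  bls_transport : transported 1 lam y0 y;
  bls_boundary : forall t, 0 < t -> y 0 t = G1 *m y 1 t;
  bls_in_space : forall t, 0 <= t -> in_space S (y ^~ t)
}.

Definition bls_exp_stable S : Prop :=
  exists C nu : R, [/\ 0 < C, 0 < nu &
    forall y0 y, bls_data S y0 -> bls_solution S y0 y ->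
    forall t, 0 <= t ->
      (space_norm S (y ^~ t) <=
       (C * expR (- nu * t))%:E * space_norm S y0)%E].

End Systems.

(* Main.v *)
Require Import Defs.
From mathcomp Require Import all_boot all_order all_algebra.
From mathcomp Require Import all_classical all_reals all_analysis.
From mathcomp Require Import measurable_realfun ess_sup_inf.
From mathcomp Require Import ring lra.

Set Implicit Arguments.
Unset Strict Implicit.
Unset Printing Implicit Defensive.

Import Order.TTheory GRing.Theory Num.Theory.
Import numFieldNormedType.Exports.

Local Open Scope classical_set_scope.
Local Open Scope ring_scope.

(** Write tau_i = 1 / lam_i. Along characteristics the profile y is determined by its
    outgoing trace u(t) = y(1, t), and with time measured in units of eps the boundary
    condition becomes a delay equation u_i(t) = sum_j G1_ij u_j(t - tau_i) + forcing.
    Its solutions are finite convolutions u(t) = sum_d W(d) g(t - d) of the forcing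
    with a fundamental solution W, supported by the sums of delays
    ([delay_equation_conv]).

    Stability of the boundary-layer system in one space bounds the weights,
    |W(d)| <= C e^(-nu d), as one sees by testing with narrow tents
    ([bls_fundamental_decay]). Since sums of delays are parametrized by multi-indices,
    the weights are then summable against e^(nu' d) for nu' < nu
    ([sum_fundamental_le]). This property does not refer to a space any more and it
    gives decay in every norm that is invariant by translation in time. It is thus the
    bridge between the one space of the hypothesis and all spaces of the
    conclusion.

    The coupling is treated for continuous solutions first ([small_gain]). The
    deviation eta = u - H z from the quasi-steady state, H = (1 - G1)^-1 G2,
    satisfies the boundary-layer delay equation with forcing
    H (z(t - eps tau) - z(t)), which is of order eps because z' is bounded by z and
    eta, while z' = M z + B eta with the stable matrix M of the reduced system.
    Weighted sup bounds on z and eta close up for small eps. Only derivatives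
    of C^1 functions are needed here.

    Solutions with data in L^p are reduced to this case by integration in time: the
    primitives of z and u, after subtraction of an equilibrium, form a continuous
    solution, whose initial size is controlled by |z0| and the L^1 norm of y0, and z
    is a linear combination of them ([slow_decay]). So |z(t)| decays exponentially.
    Then the boundary condition is a delay equation for u with decaying forcing, and the
    convolution formula with Minkowski's inequality gives the decay of y
    in L^p ([profile_decay]). Finally, the norm of C^0 is the restriction of that of
    L^oo ([continuous_space_norm]), which covers continuous data. *)

(** * Linear delay equations and their fundamental solution *)

Section DifferenceEquation.
Variables (R : realType) (m : nat) (tau : 'I_m -> R) (G : 'M[R]_m).

(** The boundary values u(t) = y(1, t) of the transported components satisfy
    u = delay_op u + forcing: the i-th line takes the time tau i to travel from
    x = 0 to x = 1. *)
Definition delay_op (u : 'I_m -> R -> R) (i : 'I_m) (t : R) : R :=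
  \sum_j G i j * u j (t - tau i).

(** Column j of the k-th power of [delay_op] applied to a unit mass at time 0. It
    is a function of a real delay d rather than of a word of indices, because
    words with the same total delay may cancel; only the total weight of a delay
    is controlled by stability. *)
Definition delay_atom (k : nat) (j : 'I_m) : 'I_m -> R -> R :=
  iter k delay_op (fun i d => ((i == j) && (d == 0))%:R).

(** Weight of the delay d in component i of the response to an impulse in
    component j. Paths of at most N - 1 reflections are counted, which are all of
    them when d < N * tmin, where tmin is a lower bound of the delays. *)
Definition fundamental (N : nat) (j i : 'I_m) (d : R) : R :=
  \sum_(k < N) delay_atom k j i d.

(** All total delays of paths that use each line less than N times. *)
Definition delays (N : nat) : seq R :=
  undup [seq \sum_i (n i)%:R * tau i | n : {ffun 'I_m -> 'I_N}].

Lemma iter_delay_opD k (f g : 'I_m -> R -> R) i t :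
  iter k delay_op (fun i t => f i t + g i t) i t =
  iter k delay_op f i t + iter k delay_op g i t.
Proof.
elim: k i t => [//|k IH] i t; rewrite !iterS /delay_op.
by under eq_bigr do rewrite IH mulrDr; rewrite big_split.
Qed.

(** The condition on s is on multi-indices and not on the support of the atoms:
    it is stable under the shift d |-> d - tau i of the inductive step, whereas
    supports may shrink by cancellation. *)
Lemma iter_delay_op_conv k (g : 'I_m -> R -> R) i t (s : seq R) : uniq s ->
  (forall n : 'I_m -> nat,
     (\sum_i n i)%N = k -> \sum_i (n i)%:R * tau i \in s) ->
  iter k delay_op g i t =
  \sum_j \sum_(d <- s) delay_atom k j i d * g j (t - d).
Proof.
elim: k i t s => [|k IH] i t s us Hs.
  have s0 : 0 \in s.
    have := Hs (fun=> 0%N); rewrite big1 // => /(_ erefl).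
    by rewrite big1 // => l _; rewrite mul0r.
  rewrite (bigD1 i) //= [X in _ + X]big1 ?addr0; last first.
    move=> j ji; rewrite big1 // => d _; rewrite /delay_atom /=.
    by rewrite eq_sym (negbTE ji) mul0r.
  rewrite (bigD1_seq 0) //= big1 ?addr0; last first.
    by move=> d d0; rewrite /delay_atom /= (negbTE d0) andbF mul0r.
  by rewrite /delay_atom /= !eqxx mul1r subr0.
rewrite iterS /delay_op; pose s' := [seq d - tau i | d <- s].
have us' : uniq s' by rewrite map_inj_uniq //; exact: addIr.
under eq_bigr => l _.
  rewrite (IH l (t - tau i) s') //; last first.
    move=> n nk; apply/mapP.
    exists (\sum_j (n j + (j == i))%N%:R * tau j); last first.
      under [in RHS]eq_bigr do rewrite natrD mulrDl.
      suff e : \sum_j (j == i)%:R * tau j = tau i by rewrite big_split /= e addrK.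
      rewrite (bigD1 i) //= eqxx mul1r big1 ?addr0 // => j /negbTE ->.
      by rewrite mul0r.
    apply: Hs; rewrite big_split /= nk (bigD1 i) //= eqxx.
    by rewrite big1 ?addn0 ?addn1 // => j /negbTE ->.
  rewrite mulr_sumr.
  over.
rewrite exchange_big; apply: eq_bigr => j _.
under eq_bigr do rewrite /s' big_map mulr_sumr.
rewrite exchange_big /=; apply: eq_bigr => d _.
rewrite /delay_op mulr_suml; apply: eq_bigr => l _.
by rewrite mulrA; congr (_ * g j _); lra.
Qed.

Hypothesis tau_gt0 : forall i, 0 < tau i.
Variable tmin : R.
Hypothesis tmin_gt0 : 0 < tmin.
Hypothesis tmin_le : forall i, tmin <= tau i.

(** Each application of [delay_op] looks at least tmin into the past. *)
Lemma iter_delay_op_lt k (u : 'I_m -> R -> R) i t :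
  (forall i t, t < 0 -> u i t = 0) -> t < k%:R * tmin ->
  iter k delay_op u i t = 0.
Proof.
move=> u0; elim: k i t => [|k IH] i t; first by rewrite mul0r; exact: u0.
move=> tk; rewrite iterS /delay_op big1 // => j _; rewrite IH ?mulr0 //.
by have := tmin_le i; move: tk; rewrite -natr1; lra.
Qed.

Lemma delay_atom_lt k j i d : d < k%:R * tmin -> delay_atom k j i d = 0.
Proof.
apply: iter_delay_op_lt => {}i t t0.
by rewrite [t == 0]lt_eqF // andbF.
Qed.

Lemma fundamental_widen N N' j i d : (N <= N')%N -> d < N%:R * tmin ->
  fundamental N' j i d = fundamental N j i d.
Proof.
move=> NN' dN; rewrite /fundamental -(subnKC NN') big_split_ord /=.
rewrite [X in _ + X]big1 ?addr0 // => k _; apply: delay_atom_lt.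
apply: lt_le_trans dN _; rewrite ler_wpM2r ?(ltW tmin_gt0) // ler_nat.
exact: leq_addr.
Qed.

Lemma delays_uniq N : uniq (delays N).
Proof. exact: undup_uniq. Qed.

Lemma sum_delay_op_conv N (g : 'I_m -> R -> R) i t :
  \sum_(k < N) iter k delay_op g i t =
  \sum_j \sum_(d <- delays N) fundamental N j i d * g j (t - d).
Proof.
under eq_bigr => k _.
  rewrite (@iter_delay_op_conv k g i t (delays N) (delays_uniq N)); last first.
    move=> n nk; rewrite /delays mem_undup.
    have nN j : (n j < N)%N.
      apply: leq_ltn_trans (ltn_ord k); rewrite -[X in (_ <= X)%N]nk.
      by rewrite (bigD1 j) //= leq_addr.
    apply/mapP; exists [ffun j => Ordinal (nN j)]; first by rewrite mem_enum.
    by apply: eq_bigr => j _; rewrite ffunE.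
  over.
rewrite exchange_big; apply: eq_bigr => j _; rewrite exchange_big /=.
by apply: eq_bigr => d _; rewrite /fundamental mulr_suml.
Qed.

(** Neumann series: u = g + T u gives u = g + T g + ... + T^(N-1) g + T^N u, and
    T^N u vanishes up to time N * tmin. *)
Lemma delay_equation_iter N (u g : 'I_m -> R -> R) i t :
  (forall i t, t < 0 -> u i t = 0) ->
  (forall i t, u i t = g i t + delay_op u i t) ->
  t < N%:R * tmin -> u i t = \sum_(k < N) iter k delay_op g i t.
Proof.
move=> u0 ug tN.
have -> : u i t = \sum_(k < N) iter k delay_op g i t + iter N delay_op u i t.
  elim: N {tN} => [|N IH]; first by rewrite big_ord0 add0r.
  rewrite {}IH big_ord_recr /= -addrA; congr (_ + _).
  have {1}-> : u = (fun i t => g i t + delay_op u i t).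
    by apply/funext => j; apply/funext => s; rewrite -ug.
  by rewrite iter_delay_opD -iterSr.
by rewrite iter_delay_op_lt // addr0.
Qed.

Lemma delay_equation_conv N (u g : 'I_m -> R -> R) i t :
  (forall i t, t < 0 -> u i t = 0) ->
  (forall i t, u i t = g i t + delay_op u i t) ->
  t < N%:R * tmin ->
  u i t = \sum_j \sum_(d <- delays N | d <= t) fundamental N j i d * g j (t - d).
Proof.
move=> u0 ug tN; rewrite (delay_equation_iter i u0 ug tN) sum_delay_op_conv.
apply: eq_bigr => j _; rewrite [RHS]big_mkcond; apply: eq_bigr => d _.
case: ifPn => //; rewrite -ltNge => td.
have tdlt : t - d < 0 by rewrite subr_lt0.
have := ug j (t - d); rewrite u0 // /delay_op big1 ?addr0.
  by move=> <-; rewrite mulr0.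
by move=> l _; rewrite u0 ?mulr0 //; have := tau_gt0 j; lra.
Qed.

Definition fundamental_decay (C nu : R) : Prop :=
  forall N j i d, d < N%:R * tmin ->
    `|fundamental N j i d| <= C * expR (- nu * d).

Lemma geometric_le (q : R) N : 0 <= q < 1 -> \sum_(k < N) q ^+ k <= (1 - q)^-1.
Proof.
move=> /andP[q0 q1]; have p : 0 < 1 - q by rewrite subr_gt0.
rewrite -(ler_pM2l p) divff ?gt_eqF // -opprB mulNr -subrX1 opprB.
by rewrite lerBlDr lerDl exprn_ge0.
Qed.

Lemma fundamental_lt0 N j i d : d < 0 -> fundamental N j i d = 0.
Proof.
move=> d0; rewrite /fundamental big1 // => k _; apply: delay_atom_lt.
by apply: lt_le_trans d0 _; rewrite mulr_ge0 // ltW.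
Qed.

(** The set of delays is a projection of a grid, so the sum is at most a sum of
    C e^(-(nu - nu') k.tau) over multi-indices k, which is a product of m
    geometric series. Hence pointwise decay of the weights gives
    their weighted summability. *)
Lemma sum_fundamental_le C nu nu' : nu' < nu -> fundamental_decay C nu ->
  exists K, forall N j i,
    \sum_(d <- delays N | d < N%:R * tmin)
       `|fundamental N j i d| * expR (nu' * d) <= K.
Proof.
move=> nunu dec.
pose q i := expR (- (nu - nu') * tau i).
have q01 k : 0 <= q k < 1.
  by rewrite expR_ge0 expR_lt1 /=; have := tau_gt0 k; nra.
exists (C * \prod_i (1 - q i)^-1) => N j i.
have C0 : 0 <= C.
  have := dec 1%N j i 0; rewrite mul1r mulr0 expR0 mulr1 => /(_ tmin_gt0).
  exact: le_trans.
apply: (@le_trans _ _ (\sum_(d <- delays N) C * expR (- (nu - nu') * d))).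
  rewrite big_mkcond; apply: ler_sum => d _; case: ifPn => [dN|_].
    apply: le_trans (_ : C * expR (- nu * d) * expR (nu' * d) <= _).
      by rewrite ler_wpM2r ?expR_ge0 // dec.
    by rewrite -mulrA -expRD; rewrite le_eqVlt; apply/orP; left; apply/eqP; congr (_ * expR _); ring.
  by rewrite mulr_ge0 ?expR_ge0.
have undup_le (s : seq R) (F : R -> R) : (forall d, 0 <= F d) ->
    \sum_(d <- undup s) F d <= \sum_(d <- s) F d.
  move=> F0; elim: s => [|a s IH]; first by rewrite !big_nil.
  rewrite /= big_cons; case: ifP => _; last by rewrite big_cons lerD2l.
  by apply: le_trans IH _; rewrite lerDr.
apply: le_trans (undup_le _ _ _) _.
  by move=> d; rewrite mulr_ge0 ?expR_ge0.
rewrite big_map big_enum /= -mulr_sumr ler_wpM2l //.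
have -> : \sum_(n : {ffun 'I_m -> 'I_N})
    expR (- (nu - nu') * (\sum_i (n i)%:R * tau i)) =
    \sum_(n : {ffun 'I_m -> 'I_N}) \prod_i q i ^+ (n i).
  apply: eq_bigr => n _; rewrite mulr_sumr expR_sum; apply: eq_bigr => l _.
  by rewrite /q -expRM_natl; congr expR; ring.
rewrite -(bigA_distr_bigA (fun i (k : 'I_N) => q i ^+ k)) /=.
apply: ler_prod => l _; rewrite geometric_le // andbT.
by apply: sumr_ge0 => k _; rewrite exprn_ge0 //; case/andP: (q01 l).
Qed.

Lemma archi_bound_mul (a t : R) : 0 < a -> exists N : nat, t < N%:R * a.
Proof.
move=> a0; exists (Num.bound (`|t| / a)).
rewrite -ltr_pdivrMr //; apply: le_lt_trans (archi_boundP _).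
  by rewrite ler_pM2r ?invr_gt0 // ler_norm.
by rewrite divr_ge0 // ltW.
Qed.

(** Exponentially decaying forcing gives exponentially decaying solutions, up to a
    finite time t and with a bound that does not depend on t. *)
Lemma delay_equation_decay K nu r (u g : 'I_m -> R -> R) t :
  (forall N j i, \sum_(d <- delays N | d < N%:R * tmin)
     `|fundamental N j i d| * expR (nu * d) <= K) ->
  (forall i t, t < 0 -> u i t = 0) ->
  (forall i t, u i t = g i t + delay_op u i t) ->
  (forall j s, 0 <= s <= t -> `|g j s| <= r * expR (- nu * s)) -> 0 <= t ->
  forall i, `|u i t| <= m%:R * K * r * expR (- nu * t).
Proof.
move=> HK u0 ug gr t0 i; have [N tN] := archi_bound_mul t tmin_gt0.
rewrite (delay_equation_conv i u0 ug tN).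
have r0 : 0 <= r.
  have := le_trans (normr_ge0 _) (gr i t _); rewrite t0 lexx => /(_ isT).
  by rewrite pmulr_lge0 // expR_gt0.
apply: le_trans (ler_norm_sum _ _ _) _.
apply: (@le_trans _ _ (\sum_(j < m) K * r * expR (- nu * t))); last first.
  by rewrite sumr_const card_ord -[leLHS]mulr_natl !mulrA.
apply: ler_sum => j _; apply: le_trans (ler_norm_sum _ _ _) _.
apply: le_trans (_ : (\sum_(d <- delays N | d < N%:R * tmin)
    `|fundamental N j i d| * expR (nu * d)) * (r * expR (- nu * t)) <= _); last first.
  by rewrite -mulrA ler_wpM2r // mulr_ge0 ?expR_ge0.
rewrite mulr_suml big_mkcond [leRHS]big_mkcond; apply: ler_sum => d _.
case: ifPn => [dt|_]; last by case: ifP => // _; rewrite !mulr_ge0 ?expR_ge0.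
rewrite (le_lt_trans dt tN) normrM -mulrA.
have [d0|d0] := ltP d 0; first by rewrite fundamental_lt0 // normr0 !mul0r.
rewrite ler_wpM2l //; apply: le_trans (gr _ _ _) _.
  by rewrite subr_ge0 dt /= lerBlDr lerDl.
by rewrite mulrCA ler_wpM2l // -expRD ler_expR; lra.
Qed.

End DifferenceEquation.

(** * Norms of L^p(0,1) and affine changes of variable *)

Section LpToolbox.
Import HBNNSimple.
Variable R : realType.
Implicit Types (p : \bar R) (f g : R -> R) (c : R).

Local Notation I01 := (`]0, 1[%classic : set R).
Local Notation leb := (@lebesgue_measure R).
Local Notation mu := (@lebesgue01 R).

(** The norm of L^p(0,1), with the values outside of (0,1), which may fail to be
    measurable, replaced by 0. *)
Definition lnorm (p : \bar R) (f : R -> R) : \bar R :=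
  Lnorm mu p (fun x : R => ((f \_ I01) x)%:E).

Lemma lebesgue01T : mu [set: R] = 1%E.
Proof.
by rewrite /lebesgue01 /= /mrestr setTI lebesgue_measure_itv /= lte_fin ltr01 oppr0 addr0.
Qed.

Lemma ae_lebesgue01 (P : R -> Prop) (A : set R) : measurable A -> leb A = 0%E ->
  (forall x, 0 < x < 1 -> ~ A x -> P x) -> \forall x \ae mu, P x.
Proof.
move=> mA A0 H; exists (A `|` ~` I01); split.
- by apply: measurableU => //; exact: measurableC.
- rewrite /lebesgue01 /= /mrestr; apply/eqP; rewrite -measure_le0 -A0.
  apply: le_measure; rewrite ?inE //.
    by apply: measurableI => //; apply: measurableU => //; exact: measurableC.
  by move=> x [[//|]].
- move=> x /= nP; have [xI|xI] := pselect (I01 x); last by right.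
  by left; apply: contrapT => nA; apply: nP; apply: H.
Qed.

Lemma ae_lebesgue01W (P : R -> Prop) :
  (forall x, 0 < x < 1 -> P x) -> \forall x \ae mu, P x.
Proof.
by move=> H; apply: (@ae_lebesgue01 _ set0) => [||x x01 _] //; exact: H.
Qed.

Lemma patch01E f x : 0 < x < 1 -> (f \_ I01) x = f x.
Proof. by move=> x01; rewrite patchE mem_set //= in_itv. Qed.

(** Without measurability outside of (0,1): a simple function below f can itself
    be cut off outside of (0,1) without changing its integral. *)
Lemma lnormE p f : (forall x, 0 <= f x) -> (1 <= p)%E ->
  Lnorm mu p (fun x : R => (f x)%:E) = lnorm p f.
Proof.
move=> f0 p1; rewrite /lnorm unlock; case: p p1 => [p||] //= p1.
  congr (poweR _ _); apply/eqP; rewrite eq_le; apply/andP; split; last first.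
    rewrite !ge0_integralTE; try by move=> x; rewrite lee_fin powR_ge0.
    apply: ereal_sup_le => _ [h hf] <-; exists h => //= x; apply: le_trans (hf x) _; rewrite lee_fin.
    rewrite ge0_ler_powR ?nnegrE //; first by move: p1; rewrite lee_fin; lra.
    by rewrite patchE; case: ifP => // _; rewrite normr0.
  rewrite ge0_integralTE; last by move=> x; rewrite lee_fin powR_ge0.
  apply: ge_ereal_sup => _ [h hf] <-.
  have mI : measurable I01 by [].
  rewrite -integralT_nnsfun [leRHS]ge0_integralTE; last by move=> x; rewrite lee_fin powR_ge0.
  apply: ereal_sup_ubound => /=; exists (proj_nnsfun h mI).
    move=> x; rewrite -mrestrict /= !patchE; case: ifPn => _; last first.
      by rewrite lee_fin powR_ge0.
    exact: hf.
  rewrite -!integralT_nnsfun; apply: ge0_ae_eq_integral => //.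
  - exact/measurable_EFinP.
  - exact/measurable_EFinP.
  - by move=> x _; rewrite lee_fin.
  - by move=> x _; rewrite lee_fin.
  - apply: ae_lebesgue01W => x x01 _ /=.
    by rewrite /mindic indicE mem_set ?mulr1 //= in_itv.
case: ifPn => // _; apply: eq_ess_sup.
by apply: ae_lebesgue01W => x x01 /=; rewrite patch01E.
Qed.

Lemma lnorm_ge0 p f : (0 <= lnorm p f)%E. Proof. exact: Lnorm_ge0. Qed.

Lemma lebesgue_affine (a b : R) (A : set R) : a != 0 -> measurable A ->
  leb ((fun x => a * x + b) @^-1` A) = ((`|a|^-1)%:E * leb A)%E.
Proof.
move=> a0 mA.
pose phi : measurableTypeR R -> measurableTypeR R := fun x => a * x + b.
have mphi : measurable_fun setT phi.
  by apply: measurable_funD => //; exact: measurable_funM.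
have meas : leb A = (`|a|%:E * leb (phi @^-1` A))%E.
  apply: (@lebesgue_measure_unique R
    (mscale (NngNum (normr_ge0 a)) [the measure _ _ of pushforward leb phi])) => //.
  move=> _ [[x1 x2]] _ <- /=; rewrite /mscale /=.
  have [an|ap|ae] := ltgtP a 0; last by rewrite ae eqxx in a0.
    rewrite /pushforward (_ : _ @^-1` _ = `[(x2 - b) / a, (x1 - b) / a[%classic); last first.
      apply/seteqP; split=> y /=; rewrite !in_itv /= /phi.
        by move=> /andP[h1 h2]; rewrite ler_ndivrMr // ltr_ndivlMr //; lra.
      by rewrite ler_ndivrMr // ltr_ndivlMr // => /andP[h1 h2]; lra.
    rewrite !lebesgue_measure_itv /= !lte_fin ltr_nM2r ?invr_lt0 // ltrD2r.
    case: ifP => _; last by rewrite mule0.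
    by rewrite ltr0_norm // -!EFinD -EFinM; congr EFin; field; rewrite lt_eqF.
  rewrite /pushforward (_ : _ @^-1` _ = `](x1 - b) / a, (x2 - b) / a]%classic); last first.
    apply/seteqP; split=> y /=; rewrite !in_itv /= /phi.
      by move=> /andP[h1 h2]; rewrite ltr_pdivrMr // ler_pdivlMr //; lra.
    by rewrite ltr_pdivrMr // ler_pdivlMr // => /andP[h1 h2]; lra.
  rewrite !lebesgue_measure_itv /= !lte_fin ltr_pM2r ?invr_gt0 // ltrD2r.
  case: ifP => _; last by rewrite mule0.
  by rewrite gtr0_norm // -!EFinD -EFinM; congr EFin; field; rewrite gt_eqF.
by rewrite meas muleA -EFinM mulVf ?normr_eq0 // mul1e.
Qed.

Lemma measurable_affine (a b : R) :
  measurable_fun (setT : set (measurableTypeR R))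
    (fun x => a * x + b : measurableTypeR R).
Proof. by apply: measurable_funD => //; exact: measurable_funM. Qed.

Lemma ge0_integral_affine (a b : R) (h : R -> \bar R) : a != 0 ->
  measurable_fun setT h -> (forall x, 0 <= h x)%E ->
  (\int[leb]_x h (a * x + b)%R = (`|a|^-1)%:E * \int[leb]_x h x)%E.
Proof.
move=> a0 mh h0; have ia : 0 <= `|a|^-1 by rewrite invr_ge0.
have := ge0_integral_pushforward (measurable_affine a b) leb measurableT mh
  (fun y _ => h0 y).
rewrite preimage_setT => <-.
have := @ge0_integral_mscale _ _ _ leb setT measurableT (NngNum ia) h mh (fun x _ => h0 x).
move=> <-; apply: eq_measure_integral => [|? A mA _]; first exact: measurable_affine.
exact: lebesgue_affine.
Qed.

Lemma measurable_patch01 f : measurable_fun I01 f -> measurable_fun setT (f \_ I01).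
Proof. by move=> mf; apply/(measurable_restrictT f). Qed.

Lemma measurable_powR_patch01 (q : R) f : measurable_fun I01 f ->
  measurable_fun setT (fun x => (`|(f \_ I01) x| `^ q)%:E).
Proof.
move=> mf; apply/measurable_EFinP; apply: (measurableT_comp (measurable_powR q)).
by apply: measurableT_comp => //; exact: measurable_patch01.
Qed.

Lemma integral_lebesgue01 (h : R -> \bar R) :
  (forall x, ~ (0 < x < 1) -> h x = 0%E) ->
  (\int[mu]_x h x = \int[leb]_x h x)%E.
Proof.
move=> h0.
have hE : h = h \_ I01.
  apply/funext => x; rewrite patchE; case: ifPn => // /negP xI; apply: h0.
  by move=> x01; apply: xI; rewrite mem_set //= in_itv.
have hI (nu : {measure set (measurableTypeR R) -> \bar R}) :
    (\int[nu]_x h x = \int[nu]_(x in I01) h x)%E.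
  by rewrite [RHS]integral_mkcond -hE.
rewrite !hI; apply: eq_measure_integral => A mA AI.
by rewrite /lebesgue01 /= /mrestr setIidl.
Qed.

(** The form of change of variables used throughout: only an inequality, where f
    may live on a part of (0,1) that the affine map sends into (0,1), and one
    exceptional point is allowed. The factor is at least 1 so that it is valid
    for every p. *)
Lemma lnorm_le_affine p f g (a b x0 : R) : (1 <= p)%E -> a != 0 ->
  measurable_fun I01 f -> measurable_fun I01 g ->
  (forall x, 0 < x < 1 -> x != x0 -> f x != 0 ->
     0 < a * x + b < 1 /\ `|f x| <= `|g (a * x + b)|) ->
  (lnorm p f <= (Num.max 1 `|a|^-1)%:E * lnorm p g)%E.
Proof.
move=> p1 a0 mf mg fg; set c := Num.max 1 `|a|^-1.
pose phi : measurableTypeR R -> measurableTypeR R := fun x => a * x + b.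
have mphi : measurable_fun setT phi.
  by apply: measurable_funD => //; exact: measurable_funM.
have c1 : 1 <= c by rewrite le_max lexx.
have ca : `|a|^-1 <= c by rewrite le_max lexx orbT.
have c0 : 0 <= c by apply: le_trans c1.
have a'0 : 0 <= `|a|^-1 by rewrite invr_ge0.
have mx0 : measurable [set x0] by [].
rewrite /lnorm unlock; case: p p1 => [p||] //= p1.
  have {}p1 : 1 <= p by rewrite -lee_fin.
  have p0 : p != 0 by rewrite gt_eqF //; lra.
  pose h x := (`|(g \_ I01) x| `^ p)%:E.
  have h0 x : (0 <= h x)%E by rewrite lee_fin powR_ge0.
  have mh : measurable_fun setT h by exact: measurable_powR_patch01.
  have hle : (\int[mu]_x (`|(f \_ I01) x| `^ p)%:E <= c%:E * \int[mu]_x h x)%E.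
    apply: (@le_trans _ _ (\int[mu]_x (h \o phi) x)%E).
      apply: ae_ge0_le_integral => //.
      - exact: measurable_powR_patch01.
      - by move=> x _; exact: h0.
      - exact: (measurableT_comp mh mphi).
      - apply: (ae_lebesgue01 mx0); first exact: lebesgue_measure_set1.
        move=> x x01 /eqP xx0 _; rewrite /= patch01E // /h.
        have [->|fx] := eqVneq (f x) 0; first by rewrite normr0 powR0 // lee_fin powR_ge0.
        have [y01 fgx] := fg x x01 xx0 fx.
        by rewrite patch01E // lee_fin ge0_ler_powR ?nnegrE //; lra.
    have := ge0_integral_pushforward mphi mu measurableT mh (fun y _ => h0 y).
    rewrite preimage_setT => <-.
    have sc := @ge0_integral_mscale _ _ _ leb setT measurableT (NngNum a'0) h mh (fun x _ => h0 x).
    apply: (@le_trans _ _ ((`|a|^-1)%:E * \int[leb]_x h x)%E); last first.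
      rewrite -integral_lebesgue01; last first.
        move=> x nx; rewrite /h patchE ifF ?normr0 ?powR0 //.
        by apply/negbTE/negP => /set_mem /=; rewrite in_itv.
      by apply: lee_wpmul2r; [exact: integral_ge0 | rewrite lee_fin].
    rewrite -[leRHS]sc; apply: ge0_le_measure_integral => // S mS.
    rewrite [leRHS](_ : _ = leb ((fun x => a * x + b) @^-1` S)); last first.
      by rewrite (lebesgue_affine b a0 mS).
    rewrite /pushforward /= /mrestr.
    apply: le_measure; rewrite ?inE //=.
      apply: measurableI => //; rewrite -[X in measurable X]setTI; exact: mphi.
    rewrite -[X in measurable X]setTI; exact: mphi.
  apply: (@le_trans _ _ ((c%:E * \int[mu]_x h x) `^ p^-1)%E).
    apply: gt0_ler_poweR => //; first by rewrite invr_ge0; lra.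
    - by rewrite in_itv /= leey andbT integral_ge0 // => x _; rewrite lee_fin powR_ge0.
    - by rewrite in_itv /= leey andbT mule_ge0 ?lee_fin // integral_ge0.
  rewrite poweRM ?lee_fin //; last by rewrite integral_ge0.
  apply: lee_wpmul2r; first exact: poweR_ge0.
  rewrite poweR_EFin lee_fin -[leRHS]powRr1 //; apply: ler_powR => //.
  by rewrite invf_le1 //; lra.
have muT : (0 < mu [set: R])%E by rewrite lebesgue01T lte_fin.
rewrite muT.
set S := ess_sup mu (abse \o (fun x : R => ((g \_ I01) x)%:E)).
have S0 : (0 <= S)%E by apply: ess_sup_gee => //; apply: aeW => x /=.
apply: (@le_trans _ _ S); last first.
  by rewrite -[leLHS]mul1e; apply: lee_wpmul2r => //; rewrite lee_fin.
apply/ess_supP.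
have [A [mA A0 HA]] := ess_sup_ge mu (abse \o (fun x : R => ((g \_ I01) x)%:E)).
have mB : measurable (phi @^-1` (A `&` I01)).
  by rewrite -[X in measurable X]setTI; apply: mphi => //; exact: measurableI.
apply: (@ae_lebesgue01 _ (phi @^-1` (A `&` I01) `|` [set x0])).
- exact: measurableU.
- apply/eqP; rewrite -measure_le0; apply: le_trans (measureU2 _ _ _) _ => //.
  rewrite [X in (_ + X)%E]lebesgue_measure_set1 adde0.
  apply: (@le_trans _ _ (leb ((fun x => a * x + b) @^-1` (A `&` I01)))) => //.
  rewrite lebesgue_affine //; last exact: measurableI.
  by move: A0; rewrite /lebesgue01 /= /mrestr => ->; rewrite mule0.
- move=> x x01 /not_orP[xA /eqP xx0] /=; rewrite patch01E //.
  have [->|fx] := eqVneq (f x) 0; first by rewrite normr0.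
  have [y01 fgx] := fg x x01 xx0 fx.
  apply: contrapT => Sf; apply: xA; split => /=; last by rewrite in_itv.
  apply: HA => /=; rewrite patch01E // => gS; apply: Sf.
  by apply: le_trans gS; rewrite lee_fin.
Qed.

End LpToolbox.

Section LpNorms.
Variable R : realType.
Implicit Types (p : \bar R) (f g : R -> R) (c : R).

Local Notation I01 := (`]0, 1[%classic : set R).
Local Notation leb := (@lebesgue_measure R).
Local Notation mu := (@lebesgue01 R).

Lemma lnorm_le p f g : (1 <= p)%E ->
  measurable_fun I01 f -> measurable_fun I01 g ->
  (forall x, 0 < x < 1 -> `|f x| <= `|g x|) -> (lnorm p f <= lnorm p g)%E.
Proof.
move=> p1 mf mg fg.
have := @lnorm_le_affine _ p f g 1 0 0 p1 (oner_neq0 R) mf mg.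
rewrite normr1 invr1 maxxx mul1e; apply=> x x01 _ _.
by rewrite mul1r addr0; split => //; exact: fg.
Qed.

Lemma lnormZ_le p c f : (1 <= p)%E -> measurable_fun I01 f ->
  (lnorm p (fun x => c * f x)%R <= `|c|%:E * lnorm p f)%E.
Proof.
move=> p1 mf.
have cf x : ((fun x => c * f x) \_ I01) x = c * (f \_ I01) x.
  by rewrite !patchE; case: ifP => // _; rewrite mulr0.
rewrite /lnorm unlock; case: p p1 => [p||] //= p1.
  have {}p1 : 1 <= p by rewrite -lee_fin.
  have -> : (\int[mu]_x (`|((fun x => c * f x)%R \_ I01) x| `^ p)%:E =
      (`|c| `^ p)%:E * \int[mu]_x (`|(f \_ I01) x| `^ p)%:E)%E.
    rewrite -ge0_integralZl //; last exact: measurable_powR_patch01.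
    by apply: eq_integral => x _; rewrite cf normrM powRM.
  rewrite poweRM ?lee_fin ?powR_ge0 //; last first.
    by apply: integral_ge0 => x _; rewrite lee_fin powR_ge0.
  rewrite poweR_EFin -powRrM mulfV ?powRr1 //.
  by rewrite gt_eqF //; lra.
have -> : (0 < mu [set: R])%E by rewrite lebesgue01T lte_fin.
apply/ess_supP; have := ess_sup_ge mu (abse \o (fun x : R => ((f \_ I01) x)%:E)).
apply: filterS => x /=; rewrite cf normrM EFinM => H.
by apply: lee_wpmul2l => //; rewrite lee_fin.
Qed.

Lemma lnorm1_cst p : (1 <= p)%E -> (lnorm p (fun=> 1)%R <= 1)%E.
Proof.
move=> p1; rewrite -lnormE //; case: p p1 => [p||] // p1.
  by rewrite Lnorm_cst1 lebesgue01T poweR_EFin powR1.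
rewrite unlock /=; case: ifP => // _; apply/ess_supP.
by apply: aeW => x /=; rewrite normr1.
Qed.

Lemma lnorm_le_cst p f c : (1 <= p)%E -> measurable_fun I01 f ->
  (forall x, 0 < x < 1 -> `|f x| <= c) -> (lnorm p f <= c%:E)%E.
Proof.
move=> p1 mf fc.
have c0 : 0 <= c by apply: le_trans (fc (2^-1) _) => //; lra.
apply: (@le_trans _ _ (lnorm p (fun=> c * 1)%R)).
  apply: lnorm_le => //.
  by move=> x /fc; rewrite mulr1 (ger0_norm c0).
apply: le_trans (lnormZ_le c p1 _) _ => //.
rewrite ger0_norm // -[leRHS]mule1; apply: lee_wpmul2l; rewrite ?lee_fin //.
exact: lnorm1_cst.
Qed.

Lemma lnormD_le p f g : (1 <= p)%E ->
  measurable_fun I01 f -> measurable_fun I01 g ->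
  (lnorm p (fun x => f x + g x)%R <= lnorm p f + lnorm p g)%E.
Proof.
move=> p1 mf mg; rewrite /lnorm.
have fgE x : ((fun x => f x + g x) \_ I01) x = (f \_ I01) x + (g \_ I01) x.
  by rewrite !patchE; case: ifP => // _; rewrite addr0.
under eq_Lnorm do rewrite fgE.
apply: (@eminkowski _ _ _ mu (f \_ I01) (g \_ I01)) => //;
  exact: measurable_patch01.
Qed.

Lemma lnorm_sum_le (I : eqType) (s : seq I) (P : pred I) p (F : I -> R -> R) (b : I -> R) :
  (1 <= p)%E ->
  (forall k, k \in s -> P k -> measurable_fun I01 (F k) /\ (lnorm p (F k) <= (b k)%:E)%E) ->
  (lnorm p (fun x => \sum_(k <- s | P k) F k x)%R <= (\sum_(k <- s | P k) b k)%:E)%E.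
Proof.
move=> p1; elim: s => [|a s IH] H.
  rewrite big_nil; under [fun x => _]eq_fun do rewrite big_nil.
  by apply: lnorm_le_cst => // x _; rewrite normr0.
have Hs k : k \in s -> P k -> measurable_fun I01 (F k) /\ (lnorm p (F k) <= (b k)%:E)%E.
  by move=> ks; apply: H; rewrite inE ks orbT.
rewrite big_cons; under [fun x => _]eq_fun do rewrite big_cons.
case: ifP => [Pa|_]; last exact: IH.
have [ma ba] := H a (mem_head _ _) Pa.
apply: le_trans (lnormD_le p1 ma _) _.
  rewrite (_ : (fun x => _) = (fun x => \sum_(k <- s) (if P k then F k x else 0))).
    have : {in s, forall k, measurable_fun I01 (fun x => if P k then F k x else 0)}.
      by move=> k ks; case Pk : (P k) => //; exact: (Hs k ks Pk).1.
    elim: s {IH H Hs} => [_|k s IH H].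
      rewrite (_ : (fun x => _) = cst 0); first exact: measurable_cst.
      by apply/funext => x; rewrite big_nil.
    rewrite (_ : (fun x => _) = (fun x => (if P k then F k x else 0) +
        \sum_(j <- s) (if P j then F j x else 0))); last first.
      by apply/funext => x; rewrite big_cons.
    apply: measurable_funD; first by have := H k (mem_head _ _).
    by apply: IH => l ls; have := H l; rewrite inE ls orbT => /(_ isT).
  by apply/funext => x; rewrite big_mkcond.
by rewrite EFinD; apply: leeD => //; exact: IH.
Qed.

(** Hoelder's inequality on a probability space. *)
Lemma lnorm1_le p f : (1 <= p)%E -> measurable_fun I01 f ->
  (lnorm 1 f <= lnorm p f)%E.
Proof.
move=> p1 mf; have mpf := measurable_patch01 mf.
have muT : (0 < mu [set: R])%E by rewrite lebesgue01T lte_fin.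
case: p p1 => [p||] // p1; last first.
  set S := ess_sup mu (abse \o (fun x : R => ((f \_ I01) x)%:E)).
  have -> : lnorm +oo f = S by rewrite /lnorm unlock muT.
  have S0 : (0 <= S)%E by apply: ess_sup_gee => //; apply: aeW => x /=.
  apply: (@le_trans _ _ (\int[mu]_x cst S x)%E); last first.
    by rewrite integral_cst // lebesgue01T mule1.
  rewrite /lnorm Lnorm1; apply: ae_ge0_le_integral => //.
  - by apply/measurable_EFinP; exact: measurableT_comp.
  - have := ess_sup_ge mu (abse \o (fun x : R => ((f \_ I01) x)%:E)).
    by apply: filterS => x.
have {}p1 : 1 <= p by rewrite -lee_fin.
have [->//|pn1] := eqVneq p 1.
have pgt1 : 1 < p by rewrite lt_def pn1.
pose q := (1 - p^-1)^-1.
have h : p^-1 + q^-1 = 1 by rewrite invrK subrKC.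
have ip : p^-1 < 1 by rewrite invf_lt1 //; lra.
have := @hoelder _ _ _ mu (f \_ I01) (cst 1) p q mpf.
rewrite /lnorm; move=> /(_ (measurable_cst _)).
have p0 : 0 < p by lra.
have q0 : 0 < q by rewrite invr_gt0; lra.
move=> /(_ p0 q0 h).
rewrite -/(lnorm _ _) Lnorm_cst1 lebesgue01T poweR_EFin powR1 mule1.
apply: le_trans; rewrite le_eqVlt; apply/orP; left; apply/eqP.
by apply: eq_Lnorm => x /=; rewrite mulr1.
Qed.

End LpNorms.

(** * Vector-valued functions; the sup norm as an L^oo norm *)

Section VectorNorms.
Variables (R : realType) (m : nat).
Implicit Types (v : 'cV[R]_m) (f : R -> 'cV[R]_m).

Local Notation I01 := (`]0, 1[%classic : set R).

Lemma enorm_ge0 v : 0 <= enorm v. Proof. exact: sqrtr_ge0. Qed.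

Lemma le_coord_enorm v i : `|v i 0| <= enorm v.
Proof.
rewrite /enorm -sqrtr_sqr ler_wsqrtr // (bigD1 i) //= lerDl.
by apply: sumr_ge0 => j _; exact: sqr_ge0.
Qed.

Lemma enorm_le_sum v : enorm v <= \sum_i `|v i 0|.
Proof.
have s0 : 0 <= \sum_i `|v i 0| by exact: sumr_ge0.
rewrite /enorm -(ger0_norm s0) -sqrtr_sqr ler_wsqrtr // expr2 mulr_suml.
apply: ler_sum => i _; rewrite -real_normK ?num_real // expr2 ler_wpM2l //.
by rewrite (bigD1 i) //= lerDl sumr_ge0.
Qed.

Lemma measurable_enorm f :
  (forall i, measurable_fun I01 (fun x => f x i 0)) ->
  measurable_fun I01 (fun x => enorm (f x)).
Proof.
move=> mf; apply: (measurableT_comp (continuous_measurable_fun (@sqrt_continuous R))) => //.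
by apply: measurable_sum => i; apply: measurable_funX.
Qed.

Lemma space_normE (p : \bar R) (p1 : (1 <= p)%E) f :
  space_norm (Lebesgue_space p1) f = lnorm p (fun x => enorm (f x)).
Proof. by apply: lnormE => // x; exact: enorm_ge0. Qed.

Lemma lnorm_coord_le (p : \bar R) (p1 : (1 <= p)%E) f i :
  (forall i, measurable_fun I01 (fun x => f x i 0)) ->
  (lnorm p (fun x => f x i 0%R) <= space_norm (Lebesgue_space p1) f)%E.
Proof.
move=> mf; rewrite space_normE; apply: lnorm_le => //.
  exact: measurable_enorm.
by move=> x _; rewrite [leRHS]ger0_norm ?enorm_ge0 // le_coord_enorm.
Qed.

Lemma space_norm_le_sum (p : \bar R) (p1 : (1 <= p)%E) f (b : 'I_m -> R) :
  (forall i, measurable_fun I01 (fun x => f x i 0)) ->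
  (forall i, (lnorm p (fun x => f x i 0%R) <= (b i)%:E)%E) ->
  (space_norm (Lebesgue_space p1) f <= (\sum_i b i)%:E)%E.
Proof.
move=> mf fb; rewrite space_normE.
apply: (@le_trans _ _ (lnorm p (fun x => \sum_i `|f x i 0%R|)%R)).
  apply: lnorm_le => //; first exact: measurable_enorm.
    by apply: measurable_sum => i; apply: measurableT_comp.
  move=> x _; rewrite ger0_norm ?enorm_ge0 //.
  by apply: le_trans (enorm_le_sum _) _; exact: ler_norm.
apply: lnorm_sum_le => // i _ _; split; first exact: measurableT_comp.
apply: le_trans (fb i); apply: lnorm_le => //; first exact: measurableT_comp.
by move=> x _; rewrite normr_id.
Qed.

Lemma within_coord (D : set R) f i : {within D, continuous f} ->
  {within D, continuous (fun x => f x i 0)}.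
Proof.
apply: (@within_continuous_comp _ _ _ D f (fun v : 'cV[R]_m => v i 0)).
by move=> y _; exact: coord_continuous.
Qed.

Lemma within_enorm (D : set R) f : {within D, continuous f} ->
  {within D, continuous (fun x => enorm (f x))}.
Proof.
have sq : continuous (fun v : 'cV[R]_m => \sum_i v i 0 ^+ 2).
  apply: continuous_big => [|i _]; first exact: add_continuous.
  move=> w; apply: (@continuous_comp _ _ _ (fun v : 'cV[R]_m => v i 0) (fun r => r ^+ 2)).
    exact: coord_continuous.
  exact: exprn_continuous.
apply: (@within_continuous_comp _ _ _ D f (@enorm R m)) => v _.
apply: (@continuous_comp _ _ _ (fun v : 'cV[R]_m => \sum_i v i 0 ^+ 2)); first exact: sq.
exact: sqrt_continuous.
Qed.

Lemma bounded_within01 (g : R -> R) : {within `[0, 1], continuous g} ->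
  exists K, forall x, 0 <= x <= 1 -> g x <= K.
Proof.
move=> cg; have [c _ Hc] := EVT_max (ler01 : (0 : R) <= 1) cg.
by exists (g c) => x x01; apply: Hc; rewrite in_itv.
Qed.

Lemma measurable_within01 (g : R -> R) : {within `[0, 1], continuous g} ->
  measurable_fun I01 g.
Proof.
move=> cg.
have mg : measurable_fun (`[0, 1]%classic : set R) g.
  exact: subspace_continuous_measurable_fun.
apply: measurable_funS mg => //.
by move=> x /=; rewrite !in_itv /= => /andP[/ltW -> /ltW ->].
Qed.

Lemma within_continuous_dist (g : R -> R) (D : set R) : {within D, continuous g} ->
  forall x, D x -> forall e, 0 < e ->
  exists2 d, 0 < d & forall y, D y -> `|x - y| < d -> `|g x - g y| < e.
Proof.
move=> /subspace_continuousP cg x Dx e e0.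
have /cvgrPdist_lt/(_ e e0) := cg x Dx.
move=> /nbhs_ballP[d /= d0 H]; exists d => // y Dy xy.
exact: H.
Qed.

(** Every point of [0,1] is approached by points of a set of full measure. *)
Lemma ae_within01_le (g : R -> R) S : {within `[0, 1], continuous g} ->
  (\forall x \ae (@lebesgue01 R), 0 < x < 1 -> g x <= S) ->
  forall x, 0 <= x <= 1 -> g x <= S.
Proof.
move=> cg [N [mN N0 HN]] x x01; rewrite leNgt; apply/negP => Sg.
have e0 : 0 < g x - S by rewrite subr_gt0.
have xD : `[0, 1]%classic x by rewrite /= in_itv.
have [d d0 Hd] := within_continuous_dist cg xD e0.
pose a := Num.max 0 (x - d); pose b := Num.min 1 (x + d).
have ab : a < b by rewrite /a /b gt_max !lt_min; lra.
(* the interval ]a, b[ would be contained in the null set N *)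
have HabN : `]a, b[ `<=` N `&` `]0, 1[.
  move=> y /=; rewrite in_itv /= /a /b gt_max lt_min => /andP[/andP[y0 yd] /andP[y1 yd']].
  split; last by rewrite in_itv /= y0.
  apply: HN => /= H; have y01 : 0 < y < 1 by rewrite y0.
  have := Hd y; rewrite /= in_itv /= (ltW y0) (ltW y1) => /(_ isT).
  have -> : `|x - y| < d by rewrite ltr_norml; lra.
  by move=> /(_ isT); rewrite ltr_norml => /andP[_]; have := H y01; lra.
have : ((b - a)%:E <= 0)%E.
  rewrite -N0 /lebesgue01 /= /mrestr.
  have <- : lebesgue_measure (`]a, b[%classic : set R) = (b - a)%:E.
    by rewrite lebesgue_measure_itv /= lte_fin ab.
  by apply: le_measure => //; rewrite inE //; exact: measurableI.
by rewrite lee_fin; lra.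
Qed.

(** The essential supremum of a continuous function is its maximum, so that the
    sup norm on C^0 is the restriction of the norm of L^oo. *)
Lemma continuous_space_norm (yp : (1 <= +oo :> \bar R)%E) f :
  in_space Continuous_space f ->
  in_space (Lebesgue_space yp) f /\
  space_norm (Lebesgue_space yp) f = space_norm Continuous_space f.
Proof.
rewrite /in_space => cf; have ce := within_enorm cf.
have muT : (0 < @lebesgue01 R [set: R])%E by rewrite lebesgue01T lte_fin.
have mf i : measurable_fun I01 (fun x => f x i 0).
  by apply: measurable_within01; exact: within_coord.
have nE : space_norm (Lebesgue_space yp) f = ess_sup (@lebesgue01 R) (fun x : R => (enorm (f x))%:E).
  rewrite /space_norm unlock muT; apply: eq_ess_sup; apply: aeW => x /=.
  by rewrite ger0_norm // enorm_ge0.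
have [K HK] := bounded_within01 ce.
have leK : (space_norm (Lebesgue_space yp) f <= K%:E)%E.
  rewrite nE; apply/ess_supP; apply: ae_lebesgue01W => x /andP[x0 x1].
  by rewrite lee_fin HK // !ltW.
split; first by split => //; apply: le_lt_trans leK _; rewrite ltry.
apply/eqP; rewrite eq_le; apply/andP; split.
  rewrite nE; apply/ess_supP; apply: ae_lebesgue01W => x /andP[x0 x1].
  by apply: ereal_sup_ubound => /=; exists x => //=; rewrite in_itv /= !ltW.
apply: ge_ereal_sup => _ [x /= + <-]; rewrite in_itv /= => x01.
have N0 : (0 <= space_norm (Lebesgue_space yp) f)%E by exact: Lnorm_ge0.
have Nfin : space_norm (Lebesgue_space yp) f \is a fin_num.
  by rewrite ge0_fin_numE //; apply: le_lt_trans leK _; rewrite ltry.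
rewrite -[leRHS](fineK Nfin) lee_fin; move: x x01; apply: ae_within01_le => //.
have := ess_sup_ge (@lebesgue01 R) (fun x : R => (enorm (f x))%:E).
by apply: filterS => x; rewrite -nE -[leRHS](fineK Nfin) lee_fin.
Qed.

End VectorNorms.

(** * Solving the delay equation; tent functions *)

Section DelaySolution.
Variables (R : realType) (m : nat) (tau : 'I_m -> R) (G : 'M[R]_m) (tmin : R).
Hypothesis tau_gt0 : forall i, 0 < tau i.
Hypothesis tmin_gt0 : 0 < tmin.
Hypothesis tmin_le : forall i, tmin <= tau i.

(** The Neumann series is a finite sum near each time, hence the last clause. *)
Lemma delay_equation_exists (g : 'I_m -> R -> R) :
  (forall i t, t < 0 -> g i t = 0) ->
  exists u : 'I_m -> R -> R, [/\ forall i t, t < 0 -> u i t = 0,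
    forall i t, u i t = g i t + delay_op tau G u i t &
    forall N i t, t < N%:R * tmin -> u i t = \sum_(k < N) iter k (delay_op tau G) g i t].
Proof.
move=> g0; pose T := delay_op tau G.
have widen N N' i t : (N <= N')%N -> t < N%:R * tmin ->
    \sum_(k < N') iter k T g i t = \sum_(k < N) iter k T g i t.
  move=> NN' tN; rewrite -(subnKC NN') big_split_ord /= [X in _ + X]big1 ?addr0 // => k _.
  apply: (iter_delay_op_lt G tmin_le i g0); apply: lt_le_trans tN _.
  by rewrite ler_wpM2r ?(ltW tmin_gt0) // ler_nat leq_addr.
pose nn t : nat := sval (cid (archi_bound_mul t tmin_gt0)).
have nnP t : t < (nn t)%:R * tmin by rewrite /nn; case: cid.
pose u i t := \sum_(k < nn t) iter k T g i t.
have uE N i t : t < N%:R * tmin -> u i t = \sum_(k < N) iter k T g i t.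
  move=> tN; have [h|/ltnW h] := leqP (nn t) N; first by rewrite (widen (nn t) N).
  by rewrite /u (widen N).
exists u; split => //.
  by move=> i t t0; rewrite (uE 0%N) ?big_ord0 // mul0r.
move=> i t; set N := nn t.
have tN : t < N%:R * tmin by exact: nnP.
have tN1 : t < N.+1%:R * tmin by apply: lt_le_trans tN _; rewrite ler_wpM2r ?(ltW tmin_gt0) // ler_nat.
rewrite (uE N.+1) // big_ord_recl /=; congr (_ + _).
under eq_bigr => k _ do rewrite add0n /T {1}/delay_op.
rewrite exchange_big; apply: eq_bigr => j _; rewrite (uE N); last first.
  by have := tau_gt0 i; lra.
by rewrite mulr_sumr.
Qed.

Lemma continuous_iter_delay_op k (g : 'I_m -> R -> R) :
  (forall i, continuous (g i)) ->
  forall i, continuous (iter k (delay_op tau G) g i).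
Proof.
move=> cg; elim: k => [//|k IH] i; rewrite iterS /delay_op.
apply: continuous_big => [|j _]; first exact: add_continuous.
move=> t; apply: cvgM; first exact: cvg_cst.
apply: (@continuous_comp _ _ _ (fun t => t - tau i) (iter k _ g j)); last exact: IH.
by apply: cvgB; [exact: cvg_id | exact: cvg_cst].
Qed.

Lemma fundamental_notin N j i d : d \notin delays tau N -> fundamental tau G N j i d = 0.
Proof.
move=> dN.
rewrite /fundamental /delay_atom sum_delay_op_conv big1 // => l _.
rewrite big1_seq // => d' /andP[_ d'N].
rewrite subr_eq0; have [dd'|] := eqVneq d d'; last by rewrite andbF mulr0.
by move: dN; rewrite dd' d'N.
Qed.

End DelaySolution.

Section Tent.
Variable R : realType.

Definition tent (c r s : R) : R := Num.max 0 (1 - `|s - c| / r).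

Lemma tent_ge0 c r s : 0 <= tent c r s. Proof. by rewrite /tent le_max lexx. Qed.

Lemma tent_eq0 c r s : 0 < r -> r <= `|s - c| -> tent c r s = 0.
Proof.
move=> r0 rs; rewrite /tent max_l // subr_le0 ler_pdivlMr //; lra.
Qed.

Lemma tent_neq0 c r s : 0 < r -> tent c r s != 0 -> `|s - c| < r.
Proof. by move=> r0; apply: contraNT; rewrite -leNgt => /tent_eq0 ->. Qed.

Lemma tent_le1 c r s : 0 < r -> tent c r s <= 1.
Proof.
move=> r0; rewrite /tent ge_max ler01 /= lerBlDr lerDl.
by rewrite divr_ge0 // ltW.
Qed.

Lemma tent_center c r : tent c r c = 1.
Proof. by rewrite /tent subrr normr0 mul0r subr0 max_r. Qed.

Lemma continuous_tent c r : continuous (tent c r).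
Proof.
pose h s := 1 - `|s - c| / r.
have -> : tent c r = fun s => (h s + `|h s|) / 2.
  by apply/funext => s; rewrite /tent maxr_absE add0r sub0r normrN.
have ch s : h x @[x --> s] --> h s.
  apply: cvgB; first exact: cvg_cst.
  apply: cvgM; last exact: cvg_cst.
  by apply: cvg_norm; apply: cvgB; [exact: cvg_id | exact: cvg_cst].
move=> s; apply: cvgM; last exact: cvg_cst.
by apply: cvgD; [exact: ch | apply: cvg_norm; exact: ch].
Qed.

(** Total delays are isolated: a tent of this radius sent along all paths does not
    make the contribution of the delay d overlap with that of another delay. *)
Lemma separation_radius (d r0 : R) (s : seq R) : 0 < r0 ->
  exists2 r : R, 0 < r <= r0 & forall d', d' \in s -> d' != d -> 2 * r <= `|d' - d|.
Proof.
move=> r00; elim: s => [|a s [r /andP[rgt0 rr0] Hr]]; first by exists r0; rewrite ?r00 ?lexx.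
have [->|ad] := eqVneq a d.
  exists r; first by rewrite rgt0.
  by move=> d'; rewrite inE => /orP[/eqP -> /eqP//|]; exact: Hr.
have ad0 : 0 < `|a - d| by rewrite normr_gt0 subr_eq0.
exists (Num.min r (`|a - d| / 2)).
  by rewrite lt_min rgt0 divr_gt0 //= ge_min rr0.
move=> d'; rewrite inE => /orP[/eqP -> _|ds d'd].
  have : Num.min r (`|a - d| / 2) <= `|a - d| / 2 by rewrite ge_min lexx orbT.
  by set q : R := Num.min _ _; lra.
apply: le_trans (Hr _ ds d'd); rewrite ler_pM2l // ge_min lexx //.
Qed.

End Tent.

(** * The boundary-layer system *)

Section BoundaryLayer.
Variables (R : realType) (m : nat) (lam : 'rV[R]_m) (G : 'M[R]_m).

Local Notation I01 := (`]0, 1[%classic : set R).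

Lemma continuous_col (f : 'I_m -> R -> R) :
  (forall i, continuous (f i)) -> continuous (fun x => \col_i f i x).
Proof.
move=> cf x; apply/cvgrPdist_le => e e0; near=> y.
rewrite /Num.Def.normr /= mx_normrE (bigmax_le _ (ltW e0)) //= => -[i j] _.
rewrite !mxE /=; move: i; near: y; apply: filter_forall => i.
exact: ((cvgrPdist_le _ _).1 (cf i x)).
Unshelve. all: by end_near. Qed.

Lemma continuous_in_Lebesgue (p : \bar R) (p1 : (1 <= p)%E) (f : R -> 'cV[R]_m) :
  in_space Continuous_space f -> in_space (Lebesgue_space p1) f.
Proof.
move=> cf; have mf i : measurable_fun I01 (fun x => f x i 0).
  by apply: measurable_within01; exact: within_coord.
split=> //; have [K HK] := bounded_within01 (within_enorm cf).
rewrite space_normE; apply: (@le_lt_trans _ _ K%:E); last by rewrite ltry.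
apply: lnorm_le_cst => //; first exact: measurable_enorm.
move=> x /andP[x0 x1]; rewrite ger0_norm ?enorm_ge0 //.
by apply: HK; rewrite !ltW.
Qed.

(** Continuous data give solutions in every space, and for them the sup norm and
    the L^oo norm agree. So stability in any of the spaces can be tested on
    continuous solutions, in some L^p norm. *)
Lemma bls_stable_Lebesgue (S : data_space R) : bls_exp_stable lam G S ->
  exists p : \bar R, exists p1 : (1 <= p)%E, exists C nu : R, [/\ 0 < C, 0 < nu &
    forall y0 y, bls_data G Continuous_space y0 ->
      bls_solution lam G Continuous_space y0 y -> forall t, 0 <= t ->
      (space_norm (Lebesgue_space p1) (y ^~ t) <=
        (C * expR (- nu * t))%:E * space_norm (Lebesgue_space p1) y0)%E].
Proof.
case: S => [p p1|] [C [nu [C0 nu0 H]]].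
  exists p, p1, C, nu; split => // y0 y [iy0 _] [tr bd isp] t t0; apply: H => //.
    by split => //; exact: continuous_in_Lebesgue.
  by split => // s s0; apply: continuous_in_Lebesgue; exact: isp.
have yp : (1 <= +oo :> \bar R)%E by rewrite leey.
exists +oo%E, yp, C, nu; split => // y0 y dat sol t t0.
have [_ ->] := continuous_space_norm yp dat.1.
have [_ ->] := continuous_space_norm yp (bls_in_space sol t0).
exact: H.
Qed.

Hypothesis lam_gt0 : forall i, 0 < lam 0 i.
Let tau i := (lam 0 i)^-1.
Variables tmin tmax : R.
Hypothesis tmin_gt0 : 0 < tmin.
Hypothesis tmin_le : forall i, tmin <= tau i.
Hypothesis tmax_ge : forall i, tau i <= tmax.

Let tau_gt0 i : 0 < tau i. Proof. by rewrite invr_gt0. Qed.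

(** The profile is recovered from its outgoing trace: the value at (x, t) leaves
    the domain at the time t + tau i * (1 - x). *)
Lemma bls_solution_continuous (u g : 'I_m -> R -> R) :
  (forall i, continuous (g i)) ->
  (forall i t, t < 0 -> u i t = 0) ->
  (forall i t, u i t = g i t + delay_op tau G u i t) ->
  (forall N i t, t < N%:R * tmin -> u i t = \sum_(k < N) iter k (delay_op tau G) g i t) ->
  (forall i t, tau i <= t -> g i t = 0) -> (forall i, g i 0 = 0) ->
  let y0 x := \col_i g i (tau i * (1 - x)) in
  let y x t := \col_i u i (t + tau i * (1 - x)) in
  bls_data G Continuous_space y0 /\ bls_solution lam G Continuous_space y0 y.
Proof.
move=> cg u0 ug uN gtau g00 y0 y.
have caff (i : 'I_m) (t : R) : continuous (fun x : R => t + tau i * (1 - x)).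
  move=> x; apply: cvgD; first exact: cvg_cst.
  apply: cvgM; first exact: cvg_cst.
  by apply: cvgB; [exact: cvg_cst | exact: cvg_id].
split; split.
- apply: continuous_subspaceT; apply: continuous_col => i x.
  apply: (@continuous_comp _ _ _ (fun x : R => tau i * (1 - x)) (g i)); last exact: cg.
  by have := caff i 0 x; rewrite /continuous_at; under eq_fun do rewrite add0r; rewrite add0r.
- apply/matrixP => i j; rewrite !mxE subr0 mulr1 gtau // big1 // => k _.
  by rewrite !mxE subrr mulr0 g00 mulr0.
- move=> i x t /andP[x0 x1] t0; rewrite !mxE mul1r subr0 mulr1 divr1.
  rewrite [x / _]mulrC -/(tau i).
  case: ifPn => [_|]; first by congr u; ring.
  rewrite -ltNge => tx; rewrite ug /delay_op big1 ?addr0.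
    by congr g; rewrite mulrBr mulrBr mulrBr mulrA mulVf ?gt_eqF // /tau; ring.
  by move=> j _; rewrite u0 ?mulr0 //; lra.
- move=> t t0; apply/matrixP => i j; rewrite !mxE subr0 mulr1 ug gtau ?add0r.
    rewrite /delay_op addrK; apply: eq_bigr => k _.
    by rewrite !mxE subrr mulr0 addr0.
  by lra.
- move=> t t0; have [N HN] := archi_bound_mul (t + tmax) tmin_gt0.
  have yE x : x \in (`[0, 1]%classic : set R) ->
      \col_i (\sum_(k < N) iter k (delay_op tau G) g i (t + tau i * (1 - x))) = y x t.
    rewrite inE /= in_itv /= => /andP[x0 x1]; apply/matrixP => i j; rewrite !mxE.
    rewrite -uN //; apply: le_lt_trans HN; rewrite lerD2l.
    by apply: le_trans (tmax_ge i); have := tau_gt0 i; nra.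
  apply: (subspace_eq_continuous yE).
  apply: continuous_subspaceT; apply: continuous_col => i.
  apply: continuous_big => [|k _]; first exact: add_continuous.
  move=> x; apply: (@continuous_comp _ _ _ (fun x : R => t + tau i * (1 - x)) _); first exact: caff.
  exact: continuous_iter_delay_op.
Qed.

End BoundaryLayer.

Section FundamentalDecay.
Variables (R : realType) (m : nat) (lam : 'rV[R]_m) (G : 'M[R]_m).

Local Notation I01 := (`]0, 1[%classic : set R).

Hypothesis lam_gt0 : forall i, 0 < lam 0 i.
Let tau i := (lam 0 i)^-1.
Variables tmin tmax : R.
Hypothesis tmin_gt0 : 0 < tmin.
Hypothesis tmin_le : forall i, tmin <= tau i.
Hypothesis tmax_ge : forall i, tau i <= tmax.

Let tau_gt0 i : 0 < tau i. Proof. by rewrite invr_gt0. Qed.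

(** A narrow tent isolates one weight of the fundamental solution. *)
Lemma fundamental_isolated N j i d r (u : 'I_m -> R -> R) s c :
  let g l t := (l == j)%:R * tent c r t in
  0 < r -> (forall d', d' \in delays tau N -> d' != d -> 2 * r <= `|d' - d|) ->
  u i s = \sum_(k < N) iter k (delay_op tau G) g i s ->
  `|s - d - c| < r -> u i s = fundamental tau G N j i d * tent c r (s - d).
Proof.
move=> g r0 sep -> sr; rewrite sum_delay_op_conv (bigD1 j) //=.
rewrite [X in _ + X]big1 ?addr0; last first.
  by move=> l /negbTE lj; rewrite big1 // => d' _; rewrite /g lj mul0r mulr0.
have [dN|dN] := boolP (d \in delays tau N); last first.
  rewrite (fundamental_notin _ _ _ dN) mul0r big1_seq // => d' /andP[_ d'N].
  have dd' : d' != d by apply: contraNneq dN => <-.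
  rewrite /g (tent_eq0 r0) ?mulr0 //; have := sep _ d'N dd'.
  rewrite (_ : d' - d = (s - d - c) - (s - d' - c)); last by ring.
  by have := ler_normB (s - d - c) (s - d' - c); lra.
rewrite (bigD1_seq d) ?delays_uniq //= [X in _ + X]big1_seq ?addr0.
  by rewrite /g eqxx mul1r.
move=> d' /andP[dd' d'N].
rewrite /g (tent_eq0 r0) ?mulr0 //; have := sep _ d'N dd'.
rewrite (_ : d' - d = (s - d - c) - (s - d' - c)); last by ring.
by have := ler_normB (s - d - c) (s - d' - c); lra.
Qed.

Lemma lnorm_continuous_gt0 (p : \bar R) (f : R -> R) x0 : (1 <= p)%E ->
  {within `[0, 1], continuous f} -> 0 <= x0 <= 1 -> 0 < f x0 -> (0 < lnorm p f)%E.
Proof.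
move=> p1 cf x01 fx0; rewrite lt0e lnorm_ge0 andbT; apply/eqP => f0.
have mf := measurable_within01 cf.
have p0 : (0 < p)%E by apply: lt_le_trans p1; rewrite lte_fin.
have mpf := measurable_patch01 mf.
have mE : measurable_fun (setT : set (measurableTypeR R)) (fun x : R => ((f \_ I01) x)%:E).
  exact/measurable_EFinP.
have ae0 := Lnorm_eq0_eq0 mE p0 f0.
suff : f x0 <= 0 by rewrite leNgt fx0.
move: x0 x01 {fx0}; apply: ae_within01_le => //.
move: ae0; apply: filterS => x /(_ I) + x01.
by rewrite patch01E // => -[->].
Qed.

(** Stability of the boundary-layer system in one space bounds each weight of
    the fundamental solution: put a narrow tent in component j as initial datum.
    Around the time d, component i of the solution is the
    fundamental weight times a translate of this tent, and its L^p norm is at most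
    C e^(-nu d) times that of the tent, up to the ratio of the two delays. This
    bound on the weights does not mention the space any more. *)
Theorem bls_fundamental_decay (S : data_space R) : bls_exp_stable lam G S ->
  exists C nu : R, [/\ 0 < C, 0 < nu & fundamental_decay tau G tmin C nu].
Proof.
move=> /bls_stable_Lebesgue[p [p1 [C [nu [C0 nu0 H]]]]].
pose K := Num.max 1 (tmax / tmin).
have K1 : 1 <= K by rewrite le_max lexx.
exists (K * C * expR (nu * tmax)), nu; split => //.
  by rewrite !mulr_gt0 ?expR_gt0 //; lra.
move=> N j i d dN; set w := fundamental tau G N j i d.
have CK0 : 0 <= K * C * expR (nu * tmax) * expR (- nu * d).
  by rewrite !mulr_ge0 ?expR_ge0 //; lra.
have [w0|wn0] := eqVneq w 0; first by rewrite w0 normr0.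
have d0 : 0 <= d by rewrite leNgt; apply: contra_neqN wn0 => h; exact: (fundamental_lt0 G tmin_gt0 tmin_le).
have ti := tau_gt0 i; have tj := tau_gt0 j.
pose c := tau j / 2.
have [N1 HN1] := archi_bound_mul (d + tau j + tau i) tmin_gt0.
pose N' := maxn N N1.
have HN' : d + tau j + tau i < N'%:R * tmin.
  apply: lt_le_trans HN1 _; rewrite ler_wpM2r ?(ltW tmin_gt0) // ler_nat.
  exact: leq_maxr.
have wE : fundamental tau G N' j i d = w.
  by apply: (fundamental_widen _ tmin_gt0 tmin_le) => //; exact: leq_maxl.
have r00 : 0 < Num.min (tau j / 4) (tau i / 4) by rewrite lt_min; lra.
have [r /andP[r0 rr0] sep] := separation_radius d (delays tau N') r00.
have {rr0} [rj ri] : r <= tau j / 4 /\ r <= tau i / 4.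
  by move: rr0; rewrite le_min => /andP[].
pose g (l : 'I_m) t := (l == j)%:R * tent c r t.
have g_out (l : 'I_m) t : r <= `|t - c| -> g l t = 0.
  by move=> h; rewrite /g tent_eq0 // mulr0.
have gneg l t : t < 0 -> g l t = 0.
  by move=> t0; apply: g_out; rewrite ltr0_norm /c; lra.
have gcont l : continuous (g l).
  by move=> x; apply: cvgM; [exact: cvg_cst | exact: continuous_tent].
have [u [u0 ug uN]] := delay_equation_exists G tau_gt0 tmin_gt0 tmin_le gneg.
have gtau l t : tau l <= t -> g l t = 0.
  have [->|/negbTE lj] := eqVneq l j; last by rewrite /g lj mul0r.
  by move=> h; apply: g_out; rewrite gtr0_norm /c; lra.
have gz l : g l 0 = 0 by apply: g_out; rewrite ltr0_norm /c; lra.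
have [dat sol] := bls_solution_continuous lam_gt0 tmin_gt0 tmax_ge
  gcont u0 ug uN gtau gz.
set y0 := (fun x : R => _) in dat sol; set y := (fun x t : R => _) in sol.
(* the tent arrives in the middle of the i-th line, or earlier if d is small *)
pose t := Num.max 0 (d + c - tau i / 2).
have t0 : 0 <= t by rewrite le_max lexx.
have tle : d + c - tau i / 2 <= t by rewrite le_max lexx orbT.
have tlt : t <= d + c by rewrite ge_max /c; lra.
have Hst := H y0 y dat sol t t0.
have cy0 : in_space Continuous_space y0 by exact: dat.1.
have my0 l : measurable_fun I01 (fun x => y0 x l 0).
  by apply: measurable_within01; apply: within_coord; exact: dat.1.
have myt l : measurable_fun I01 (fun x => y x t l 0).
  by apply: measurable_within01; apply: within_coord; exact: (bls_in_space sol t0).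
(* the j-th component of the data is an affinely rescaled piece of the i-th
   component of the solution, divided by the weight w *)
pose a := tau j / tau i; pose b := 1 - (tau j + d - t) / tau i.
have a0 : 0 < a by rewrite divr_gt0.
have aff x : t + tau i * (1 - (a * x + b)) = tau j * (1 - x) + d.
  by rewrite /a /b; field; rewrite gt_eqF.
have X1 : (lnorm p (fun x => y0 x j 0%R) <=
    K%:E * (`|w^-1|%:E * lnorm p (fun x => y x t i 0%R)))%E.
  apply: (@le_trans _ _ (K%:E * lnorm p (fun x => w^-1 * y x t i 0)%R)%E); last first.
    by apply: lee_wpmul2l; [rewrite lee_fin; lra | exact: lnormZ_le].
  apply: (@le_trans _ _ ((Num.max 1 `|a|^-1)%:E * lnorm p (fun x => w^-1 * y x t i 0)%R)%E).
    apply: (@lnorm_le_affine _ p _ _ a b 0); rewrite ?gt_eqF //.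
      by apply: measurable_funM.
    move=> x x01 _; rewrite !mxE -/(tau i) -/(tau j) aff /g eqxx mul1r => /(tent_neq0 r0) xr.
    have [xr1 xr2] : c - r < tau j * (1 - x) /\ tau j * (1 - x) < c + r.
      by move: xr; rewrite ltr_norml => /andP[h1 h2]; split; lra.
    have sN : tau j * (1 - x) + d < N'%:R * tmin.
      by apply: lt_trans HN'; move: xr2 rj; rewrite /c; lra.
    have := fundamental_isolated r0 sep (uN N' i _ sN).
    rewrite addrK wE => /(_ xr) ->.
    split; last by rewrite mulrA mulVf // mul1r.
    have := aff x; move: xr1 xr2 rj ri tle tlt; rewrite /c => *.
    suff : 0 < tau i * (1 - (a * x + b)) /\ tau i * (1 - (a * x + b)) < tau i.
      by move=> [h1 h2]; apply/andP; split; rewrite -(ltr_pM2l ti); lra.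
    (* either way the tent lies in the interior of the line at time t *)
    have : t = 0 \/ t = d + tau j / 2 - tau i / 2.
      by rewrite /t /c /Num.max; case: ifP; [right|left].
    by case=> ?; split; lra.
  apply: lee_wpmul2r; first exact: lnorm_ge0.
  rewrite lee_fin /K ge_max le_max lexx /= le_max; apply/orP; right.
  rewrite gtr0_norm // /a invf_div ler_pdivlMr // mulrAC ler_pdivrMr //.
  have := tmin_le j; have := tmax_ge i; nra.
have X2 : (space_norm (Lebesgue_space p1) y0 <= lnorm p (fun x => y0 x j 0%R))%E.
  rewrite space_normE; apply: lnorm_le => //; first exact: measurable_enorm.
  move=> x _; rewrite [leLHS]ger0_norm ?enorm_ge0 //.
  apply: le_trans (enorm_le_sum _) _; rewrite (bigD1 j) //= big1 ?addr0 //.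
  by move=> l /negbTE lj; rewrite mxE /g lj mul0r normr0.
have X3 := lnorm_coord_le p1 i myt.
set X := lnorm p (fun x => y0 x j 0%R) in X1 X2.
have Xpos : (0 < X)%E.
  apply: (@lnorm_continuous_gt0 _ _ (2^-1)) => //; first exact: within_coord.
    by lra.
  rewrite mxE /g eqxx mul1r (_ : tau j * (1 - 2^-1) = c); last by rewrite /c; field.
  by rewrite tent_center.
have Xfin : X \is a fin_num.
  rewrite ge0_fin_numE; last exact: ltW.
  apply: (@le_lt_trans _ _ 1%:E); last by rewrite ltry.
  apply: lnorm_le_cst => // x _; rewrite mxE /g eqxx mul1r ger0_norm ?tent_ge0 //.
  exact: tent_le1.
have w0 : 0 < `|w| by rewrite normr_gt0.
have : (X <= (K * `|w^-1| * (C * expR (- nu * t)))%:E * X)%E.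
  apply: (le_trans X1); rewrite [leLHS]muleA -EFinM [leRHS](_ : _ =
    ((K * `|w^-1|)%:E * ((C * expR (- nu * t))%:E * X))%E); last by rewrite muleA -EFinM.
  apply: lee_wpmul2l; first by rewrite lee_fin mulr_ge0 //; lra.
  apply: (le_trans X3); apply: (le_trans Hst).
  by apply: lee_wpmul2l => //; rewrite lee_fin mulr_ge0 ?expR_ge0 // ltW.
rewrite -(fineK Xfin) -EFinM lee_fin -[leLHS]mul1r ler_pM2r; last first.
  by rewrite fine_gt0 // Xpos ltey_eq Xfin.
rewrite normfV mulrAC ler_pdivlMr // mul1r => /le_trans; apply.
rewrite -!mulrA ler_pM2l ?ler_pM2l //; last by lra.
rewrite -expRD ler_expR; have := tmax_ge i; move: tle; rewrite /c => *.
by nra.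
Qed.

End FundamentalDecay.

(** * Matrix norms and the matrix exponential *)

Section EntrywiseNorm.
Variable R : realType.

(** Submultiplicative for rectangular matrices, and on column vectors the l^1 norm. *)
Definition mxl1 p q (A : 'M[R]_(p, q)) : R := \sum_i \sum_j `|A i j|.

Lemma mxl1_ge0 p q (A : 'M[R]_(p, q)) : 0 <= mxl1 A.
Proof. by apply: sumr_ge0 => i _; exact: sumr_ge0. Qed.

Lemma le_mxl1 p q (A : 'M[R]_(p, q)) i j : `|A i j| <= mxl1 A.
Proof.
rewrite /mxl1 (bigD1 i) //= (bigD1 j) //= -addrA lerDl addr_ge0 ?sumr_ge0 //.
by move=> k _; exact: sumr_ge0.
Qed.

Lemma mxl1D p q (A B : 'M[R]_(p, q)) : mxl1 (A + B) <= mxl1 A + mxl1 B.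
Proof.
rewrite /mxl1 -big_split; apply: ler_sum => i _ /=; rewrite -big_split.
by apply: ler_sum => j _; rewrite mxE ler_normD.
Qed.

Lemma mxl1N p q (A : 'M[R]_(p, q)) : mxl1 (- A) = mxl1 A.
Proof. by apply: eq_bigr => i _; apply: eq_bigr => j _; rewrite mxE normrN. Qed.

Lemma mxl1M p q r (A : 'M[R]_(p, q)) (B : 'M[R]_(q, r)) :
  mxl1 (A *m B) <= mxl1 A * mxl1 B.
Proof.
rewrite /mxl1 mulr_suml; apply: ler_sum => i _.
apply: (@le_trans _ _ (\sum_k \sum_j `|A i j| * `|B j k|)).
  apply: ler_sum => k _; rewrite mxE; apply: le_trans (ler_norm_sum _ _ _) _.
  by apply: ler_sum => j _; rewrite normrM.
rewrite exchange_big /= mulr_suml; apply: ler_sum => j _.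
rewrite -mulr_sumr ler_wpM2l //.
by rewrite [leRHS](bigD1 j) //= lerDl sumr_ge0 // => l _; exact: sumr_ge0.
Qed.

Lemma enorm_le_mxl1 k (v : 'cV[R]_k) : enorm v <= mxl1 v.
Proof.
apply: le_trans (enorm_le_sum _) _; apply: ler_sum => i _.
by rewrite big_ord1.
Qed.

Lemma mxl1_le_enorm k (v : 'cV[R]_k) : mxl1 v <= k%:R * enorm v.
Proof.
rewrite /mxl1 -[k in k%:R]card_ord -sum1_card natr_sum mulr_suml.
by apply: ler_sum => i _; rewrite big_ord1 mul1r le_coord_enorm.
Qed.

Lemma mxl1_le_coord k (v : 'cV[R]_k) b : (forall i, `|v i 0| <= b) ->
  mxl1 v <= k%:R * b.
Proof.
move=> vb; rewrite /mxl1 -[k in k%:R]card_ord -sum1_card natr_sum mulr_suml.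
by apply: ler_sum => i _; rewrite big_ord1 mul1r.
Qed.

End EntrywiseNorm.

Section MatrixExponential.
Variables (R : realType) (n : nat) (M : 'M[R]_n).

Definition mxpow k : 'M[R]_n := iter k (mulmx M) 1%:M.

Lemma mxpowSr k : mxpow k.+1 = mxpow k *m M.
Proof.
elim: k => [|k IH]; first by rewrite /mxpow /= mulmx1 mul1mx.
by rewrite /mxpow iterS -/(mxpow k.+1) {1}IH mulmxA.
Qed.

Lemma mxpow_le k : mxl1 (mxpow k) <= mxl1 (1%:M : 'M[R]_n) * mxl1 M ^+ k.
Proof.
elim: k => [|k IH]; first by rewrite expr0 mulr1.
apply: le_trans (mxl1M _ _) _; rewrite exprS mulrCA.
by apply: ler_wpM2l => //; exact: mxl1_ge0.
Qed.

(** Coefficients of the s-th derivative of entry (i, j) of the exponential. *)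
Definition expm_coeff (s : nat) (i j : 'I_n) (k : nat) : R := mxpow (k + s) i j / k`!%:R.

(** The exponential of t M, with entries given by scalar power series so that
    term-by-term differentiation is available. *)
Definition expm (t : R) : 'M[R]_n :=
  \matrix_(i, j) limn (pseries (expm_coeff 0 i j) t).

Lemma expm_coeff_cvg s i j x : cvgn (pseries (expm_coeff s i j) x).
Proof.
pose c := mxl1 (1%:M : 'M[R]_n) * mxl1 M ^+ s.
apply: normed_cvg.
have h : cvgn (series (fun k => c * exp_coeff (mxl1 M * `|x|) k)).
  have := @is_cvg_seriesZ _ _ c (is_cvg_series_exp_coeff (mxl1 M * `|x|)).
  by [].
apply: (series_le_cvg _ _ _ h) => [k|k|k].
- exact: normr_ge0.
- apply: mulr_ge0; first by rewrite mulr_ge0 ?exprn_ge0 ?mxl1_ge0.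
  by rewrite /exp_coeff /= divr_ge0 // exprn_ge0 // mulr_ge0 ?mxl1_ge0.
- rewrite /expm_coeff /exp_coeff /= normrM normrM normrX normfV.
  rewrite (ger0_norm (ler0n _ k`!)) exprMn mulrAC [leRHS]mulrA.
  rewrite ler_wpM2r ?invr_ge0 // mulrA ler_wpM2r ?exprn_ge0 //.
  apply: le_trans (le_mxl1 _ _ _) _; apply: le_trans (mxpow_le _) _.
  by rewrite /c -mulrA -exprD addnC.
Qed.

Lemma expm_coeff_diffs s i j : pseries_diffs (expm_coeff s i j) = expm_coeff s.+1 i j.
Proof.
apply/funext => k; rewrite /pseries_diffs /expm_coeff factS natrM invfM addSnnS.
by rewrite mulrCA mulVKf // pnatr_eq0.
Qed.

Lemma is_derive_expm_lim i j x :
  is_derive x (1 : R) (fun t => expm t i j) (limn (pseries (expm_coeff 1 i j) x)).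
Proof.
have -> : (fun t => expm t i j) = (fun t => limn (pseries (expm_coeff 0 i j) t)).
  by apply/funext => t; rewrite mxE.
rewrite -expm_coeff_diffs.
apply: (@pseries_snd_diffs _ _ (`|x| + 1)); rewrite ?expm_coeff_diffs;
  try exact: expm_coeff_cvg.
by rewrite [ltRHS]ger0_norm ?addr_ge0 // ltrDl.
Qed.

Lemma expm_coeff_lim_sum (c : 'I_n -> R) (f : 'I_n -> 'I_n * 'I_n) i j x :
  (forall k, mxpow k.+1 i j = \sum_l c l * mxpow k (f l).1 (f l).2) ->
  limn (pseries (expm_coeff 1 i j) x) = \sum_l c l * expm x (f l).1 (f l).2.
Proof.
move=> H; apply/cvg_lim => //.
have -> : pseries (expm_coeff 1 i j) x =
    (fun N => \sum_l c l * pseries (expm_coeff 0 (f l).1 (f l).2) x N).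
  apply/funext => N; rewrite /pseries /series /=.
  under [RHS]eq_bigr do rewrite mulr_sumr.
  rewrite exchange_big; apply: eq_bigr => k _ /=.
  rewrite /expm_coeff addn1 addn0 H !mulr_suml; apply: eq_bigr => l _.
  by rewrite !mulrA.
apply: cvg_big => [|l _]; first exact: add_continuous.
apply: cvgM; first exact: cvg_cst.
by rewrite mxE; exact: expm_coeff_cvg.
Qed.

(** Both forms of the derivative are needed: this one shows that the exponential
    solves the reduced system, and [is_derive_expmr] differentiates
    s |-> expm (T - s) *m X s. *)
Lemma is_derive_expml i j x :
  is_derive x (1 : R) (fun t => expm t i j) ((M *m expm x) i j).
Proof.
apply: (@is_derive_eq _ _ _ _ _ _ _ _ (is_derive_expm_lim i j x)).
rewrite (@expm_coeff_lim_sum (fun l => M i l) (fun l => (l, j))) ?mxE //.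
by move=> k; rewrite /mxpow iterS mxE.
Qed.

Lemma is_derive_expmr i j x :
  is_derive x (1 : R) (fun t => expm t i j) ((expm x *m M) i j).
Proof.
apply: (@is_derive_eq _ _ _ _ _ _ _ _ (is_derive_expm_lim i j x)).
rewrite (@expm_coeff_lim_sum (fun l => M l j) (fun l => (i, l))) ?mxE //.
  by apply: eq_bigr => l _; rewrite mulrC.
by move=> k; rewrite mxpowSr mxE; apply: eq_bigr => l _; rewrite mulrC.
Qed.

Lemma expm0 : expm 0 = 1%:M.
Proof.
apply/matrixP => i j; rewrite mxE; apply/cvg_lim => //.
rewrite -(cvg_shiftn 1); apply: cvg_near_cst; near=> k.
rewrite /pseries /series /= addn1 big_nat_recl // expr0 mulr1.
rewrite /expm_coeff fact0 divr1 /mxpow /= big1 ?addr0 // => l _.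
by rewrite expr0n /= mulr0.
Unshelve. all: by end_near. Qed.

End MatrixExponential.

(** * The reduced order system and Duhamel's estimate *)

Section ReducedSystem.
Variables (R : realType) (n : nat).

Lemma is_derive_col (f : R -> 'cV[R]_n) (df : 'cV[R]_n) (t : R) :
  (forall i, is_derive t (1 : R) (fun s => f s i 0) (df i 0)) -> is_derive t (1 : R) f df.
Proof.
move=> H; have dfn : derivable f t 1.
  by apply/derivable_mxP => i j; rewrite (ord1 j); exact: ex_derive.
split => //; rewrite derive_mx //; apply/matrixP => i j.
by rewrite mxE (ord1 j); exact: derive_val.
Qed.

Lemma is_derive_sumr k (f : 'I_k -> R -> R) (df : 'I_k -> R) (t : R) :
  (forall i, is_derive t (1 : R) (f i) (df i)) ->
  is_derive t (1 : R) (fun s => \sum_i f i s) (\sum_i df i).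
Proof.
move=> H; have -> : (fun s => \sum_i f i s) = \sum_i f i.
  by apply/funext => s; rewrite fct_sumE.
exact: is_derive_sum.
Qed.

Lemma is_derive_mulr (f g : R -> R) (df dg t : R) :
  is_derive t (1 : R) f df -> is_derive t (1 : R) g dg ->
  is_derive t (1 : R) (fun s => f s * g s) (df * g t + f t * dg).
Proof.
move=> Df Dg; apply: (@is_derive_eq _ _ _ _ _ _ _ _ (is_deriveM Df Dg)).
by rewrite /GRing.scale /=; ring.
Qed.

Lemma is_derive_scaler (c : R) (f : R -> R) (df t : R) :
  is_derive t (1 : R) f df -> is_derive t (1 : R) (fun s => c * f s) (c * df).
Proof.
move=> Df; have Dc := is_derive_cst c t (1 : R).
have := is_derive_mulr Dc Df; rewrite mul0r add0r; exact.
Qed.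

Lemma is_derive_expR_lin (c t : R) :
  is_derive t (1 : R) (fun s => expR (c * s)) (c * expR (c * t)).
Proof.
have D := is_derive1_comp (is_derive_expR (c * t)) (is_derive_scaler c (is_derive_id t (1 : R))).
by apply: (@is_derive_eq _ _ _ _ _ _ _ _ D); rewrite mulr1 mulrC.
Qed.

Lemma continuous_expR_lin (c : R) : continuous (fun s => expR (c * s)).
Proof.
move=> t; have D := is_derive_expR_lin c t.
by apply/differentiable_continuous/derivable1_diffP; exact: ex_derive.
Qed.

(** Integral-free comparison: f varies less than g if its derivative is dominated
    by that of g. *)
Lemma mvt_le (f g df dg : R -> R) (a b : R) : a <= b ->
  {within `[a, b], continuous f} -> {within `[a, b], continuous g} ->
  (forall x, a < x < b -> is_derive x (1 : R) f (df x)) ->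
  (forall x, a < x < b -> is_derive x (1 : R) g (dg x)) ->
  (forall x, a < x < b -> `|df x| <= dg x) -> `|f b - f a| <= g b - g a.
Proof.
move=> ab cf cg Df Dg le.
have aI : a \in `[a, b] by rewrite in_itv /= lexx.
have bI : b \in `[a, b] by rewrite in_itv /= lexx ab.
have H (s : R) : `|s| = 1 -> s * (f b - f a) <= g b - g a.
  move=> s1; pose h := (fun x => g x - s * f x).
  have Dh x : a < x < b -> is_derive x (1 : R) h (dg x - s * df x).
    by move=> xI; have := Df x xI; have := Dg x xI => *; exact: is_deriveB.
  have := @ger0_derive1_le R h a b _ _ true false _ a b aI bI ab.
  rewrite /h => h1; suff : g a - s * f a <= g b - s * f b by lra.
  apply: h1.
  - by move=> x xI; apply: ex_derive; apply: Dh; move: xI; rewrite in_itv.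
  - move=> x; rewrite in_itv /= => xI; rewrite derive1E; have := Dh x xI => Dhx.
    rewrite derive_val subr_ge0; apply: le_trans (le x xI).
    by apply: le_trans (ler_norm _) _; rewrite normrM s1 mul1r.
  - move=> x; apply: cvgB; first exact: cg.
    by apply: cvgM; [exact: cvg_cst | exact: cf].
rewrite ler_norml; apply/andP; split.
  by have := H (-1); rewrite normrN1 => /(_ erefl); lra.
by have := H 1; rewrite normr1 => /(_ erefl); lra.
Qed.

Variables (m : nat) (A : 'M[R]_n) (B : 'M[R]_(n, m)) (G1 : 'M[R]_m) (G2 : 'M[R]_(m, n)).
Local Notation M := (ros_matrix A B G1 G2).

Lemma ros_solution_expm (v : 'cV[R]_n) : ros_solution A B G1 G2 (fun t => expm M t *m v).
Proof.
have D t : is_derive t (1 : R) (fun t => expm M t *m v) (M *m (expm M t *m v)).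
  apply: is_derive_col => i.
  have -> : (fun s => (expm M s *m v) i 0) = (fun s => \sum_j expm M s i j * v j 0).
    by apply/funext => s; rewrite mxE.
  rewrite mulmxA mxE; apply: is_derive_sumr => j.
  have := is_derive_mulr (is_derive_expml M i j t) (is_derive_cst (v j 0) t (1 : R)).
  by rewrite mulr0 addr0.
split; last by move=> t _; exact: D.
apply: continuous_subspaceT => t.
by apply/differentiable_continuous/derivable1_diffP; exact: ex_derive.
Qed.

Variables (C nu1 : R).
Hypothesis C_gt0 : 0 < C.
Hypothesis nu1_gt0 : 0 < nu1.
Hypothesis ros_decay : forall z, ros_solution A B G1 G2 z -> forall t, 0 <= t ->
  enorm (z t) <= C * expR (- nu1 * t) * enorm (z 0).

Lemma expm_decay (v : 'cV[R]_n) t : 0 <= t ->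
  enorm (expm M t *m v) <= C * expR (- nu1 * t) * enorm v.
Proof.
by move=> t0; have := ros_decay (ros_solution_expm v) t0; rewrite expm0 mul1mx.
Qed.

(** A kernel vector would be a constant solution, which does not decay. *)
Lemma ros_unitmx : M \in unitmx.
Proof.
rewrite -unitmx_tr -row_free_unit -kermx_eq0; apply: contraT => /rowV0Pn[w /sub_kermxP wM w0].
pose v := w^T.
have Mv : M *m v = 0 by rewrite -[LHS]trmxK trmx_mul trmxK wM trmx0.
have sol : ros_solution A B G1 G2 (fun=> v).
  split; first by apply: continuous_subspaceT; exact: cst_continuous.
  by move=> t _; rewrite Mv; exact: is_derive_cst.
have t0 : 0 <= C / nu1 by rewrite divr_ge0 // ltW.
have := ros_decay sol t0.
have v0 : 0 < enorm v.
  rewrite lt_def enorm_ge0 andbT; apply: contra w0 => /eqP v0.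
  apply/eqP/matrixP => i j; rewrite (ord1 i) [RHS]mxE; apply/normr0_eq0/le_anti.
  by have := le_coord_enorm v j; rewrite v0 mxE normr_ge0 andbT.
rewrite -[X in X <= _]mul1r ler_pM2r //.
rewrite (_ : - nu1 * (C / nu1) = - C); last by field; rewrite gt_eqF.
rewrite expRN => h.
have e : 1 + C <= expR C by exact: expR_ge1Dx.
by move: h; rewrite ler_pdivlMr ?expR_gt0 // mul1r; lra.
Qed.

(** Variation of constants for X' = M X + F without an integral: the
    function p(s) = expm (T - s) *m X s joins expm T *m X 0 to X T and has derivative
    expm (T - s) *m F s, whose bound is the derivative of the
    explicit function g. *)
Lemma duhamel_bound (nu f T : R) (X F : R -> 'cV[R]_n) : nu < nu1 -> 0 <= f -> 0 <= T ->
  (forall i, {within `[0, T], continuous (fun t => X t i 0)}) ->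
  (forall t i, 0 < t < T -> is_derive t (1 : R) (fun s => X s i 0) ((M *m X t + F t) i 0)) ->
  (forall t, 0 < t < T -> enorm (F t) <= f * expR (- nu * t)) ->
  forall i, `|X T i 0| <= expR (- nu * T) * (C * enorm (X 0) + C * f / (nu1 - nu)).
Proof.
move=> nunu f0 T0 cX DX Ff i.
have dn : 0 < nu1 - nu by rewrite subr_gt0.
pose p s := (expm M (T - s) *m X s) i 0.
pose g s := C * f * expR (- nu1 * T) / (nu1 - nu) * expR ((nu1 - nu) * s).
have DE j (s : R) : is_derive s (1 : R) (fun s => expm M (T - s) i j) (- (expm M (T - s) *m M) i j).
  have DT : is_derive s (1 : R) (fun s => T - s) (-1).
    have := is_deriveB (is_derive_cst T s (1 : R)) (is_derive_id s (1 : R)).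
    by rewrite sub0r.
  have D := @is_derive1_comp R (fun t => expm M t i j) (fun s => T - s) s _ _
    (is_derive_expmr M i j (T - s)) DT.
  by rewrite mulrN1 in D.
have pE : p = fun s => \sum_j expm M (T - s) i j * X s j 0.
  by apply/funext => s; rewrite /p mxE.
have : `|p T - p 0| <= g T - g 0.
  apply: (@mvt_le p g (fun s => (expm M (T - s) *m F s) i 0)
    (fun s => (nu1 - nu) * g s)) => //.
  - rewrite pE => x; apply: cvg_big => [|j _]; first exact: add_continuous.
    apply: cvgM; last exact: cX.
    have := @continuous_subspaceT _ _ `[0, T]%classic (fun s => expm M (T - s) i j) _ x; apply.
    by move=> s; apply/differentiable_continuous/derivable1_diffP; exact: ex_derive.
  - apply: continuous_subspaceT => s; apply: cvgM; first exact: cvg_cst.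
    exact: continuous_expR_lin.
  - move=> s sT; rewrite pE.
    have D : is_derive s (1 : R) (fun s => \sum_j expm M (T - s) i j * X s j 0)
        (\sum_j (- (expm M (T - s) *m M) i j * X s j 0 +
                 expm M (T - s) i j * (M *m X s + F s) j 0)).
      by apply: is_derive_sumr => j; exact: (is_derive_mulr (DE j s) (DX s j sT)).
    apply: (@is_derive_eq _ _ _ _ _ _ _ _ D).
    transitivity ((- (expm M (T - s) *m M) *m X s + expm M (T - s) *m (M *m X s + F s)) i 0).
      rewrite big_split [RHS]mxE /=; congr (_ + _); last by rewrite [RHS]mxE.
      by rewrite [RHS]mxE; apply: eq_bigr => j _; rewrite [in RHS]mxE.
    by congr (_ _ 0); rewrite mulNmx mulmxDr mulmxA addKr.
  - move=> s _; have := is_derive_scaler (C * f * expR (- nu1 * T) / (nu1 - nu))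
      (is_derive_expR_lin (nu1 - nu) s).
    by rewrite mulrCA.
  - move=> s /andP[s0 sT]; apply: le_trans (le_coord_enorm _ _) _.
    apply: le_trans (expm_decay _ _) _; first by rewrite subr_ge0 ltW.
    apply: (@le_trans _ _ (C * expR (- nu1 * (T - s)) * (f * expR (- nu * s)))).
      by rewrite ler_wpM2l ?Ff ?s0 // mulr_ge0 ?expR_ge0 // ltW.
    rewrite /g le_eqVlt; apply/orP; left; apply/eqP.
    rewrite (_ : - nu1 * (T - s) = - nu1 * T + nu1 * s); last by ring.
    rewrite (_ : (nu1 - nu) * s = nu1 * s + - nu * s); last by ring.
    by rewrite !expRD; field; rewrite gt_eqF.
have pT : p T = X T i 0 by rewrite /p subrr expm0 mul1mx.
rewrite pT => H.
have p0 : `|p 0| <= C * expR (- nu1 * T) * enorm (X 0).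
  by apply: le_trans (le_coord_enorm _ _) _; rewrite subr0; exact: expm_decay.
have e1 : expR (- nu1 * T) <= expR (- nu * T) by rewrite ler_expR; nra.
have gT : g T = expR (- nu * T) * (C * f / (nu1 - nu)).
  rewrite /g (_ : - nu * T = - nu1 * T + (nu1 - nu) * T); last by ring.
  by rewrite expRD; field; rewrite gt_eqF.
have g0 : 0 <= g 0.
  by rewrite /g !mulr_ge0 ?expR_ge0 ?invr_ge0 // ltW.
have p0' : C * expR (- nu1 * T) * enorm (X 0) <= expR (- nu * T) * (C * enorm (X 0)).
  by rewrite [C * expR _]mulrC -mulrA ler_wpM2r // mulr_ge0 ?enorm_ge0 // ltW.
have := ler_normD (X T i 0 - p 0) (p 0); rewrite subrK mulrDr -gT; lra.
Qed.

End ReducedSystem.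

(** * Small gain for continuous solutions of the full system *)

Section SmallGain.
Variables (R : realType) (n m : nat) (tau : 'I_m -> R).
Variables (A : 'M[R]_n) (B : 'M[R]_(n, m)) (G1 : 'M[R]_m) (G2 : 'M[R]_(m, n)).
Variables tmin tmax : R.
Hypothesis tau_gt0 : forall i, 0 < tau i.
Hypothesis tmin_gt0 : 0 < tmin.
Hypothesis tmin_le : forall i, tmin <= tau i.
Hypothesis tmax_ge : forall i, tau i <= tmax.
Hypothesis tmax_gt0 : 0 < tmax.
Hypothesis G1_unit : 1%:M - G1 \in unitmx.
Local Notation M := (ros_matrix A B G1 G2).
Local Notation H := (invmx (1%:M - G1) *m G2).

Variables C nu1 : R.
Hypothesis C_gt0 : 0 < C.
Hypothesis nu1_gt0 : 0 < nu1.
Hypothesis ros_decay : forall z, ros_solution A B G1 G2 z -> forall t, 0 <= t ->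
  enorm (z t) <= C * expR (- nu1 * t) * enorm (z 0).

Variables nu K2 : R.
Hypothesis nu_gt0 : 0 < nu.
Hypothesis nu_lt : nu < nu1.
Hypothesis K2_ge0 : 0 <= K2.
Hypothesis fundamental_sum : forall N j i,
  \sum_(d <- delays tau N | d < N%:R * tmin)
     `|fundamental tau G1 N j i d| * expR (nu * d) <= K2.

Lemma mxaddE p q (P P' : 'M[R]_(p, q)) i j : (P + P') i j = P i j + P' i j.
Proof. by rewrite mxE. Qed.

Lemma mxsubE p q (P P' : 'M[R]_(p, q)) i j : (P - P') i j = P i j - P' i j.
Proof. by rewrite !mxE. Qed.

(** H z is the equilibrium of the boundary condition for a frozen slow variable z. *)
Lemma quasi_steadyE : G1 *m H + G2 = H.
Proof.
have e : (1%:M - G1) *m H = G2 by rewrite mulKVmx.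
by rewrite -[X in _ + X]e mulmxBl mul1mx addrC subrK.
Qed.

Lemma fundamental_sum_eps eps N j i : 0 < eps <= 1 ->
  \sum_(d <- delays tau N | d < N%:R * tmin)
     `|fundamental tau G1 N j i d| * expR (nu * eps * d) <= K2.
Proof.
move=> /andP[e0 e1]; apply: le_trans (fundamental_sum N j i); apply: ler_sum => d _.
have [d0|d0] := ltP d 0; first by rewrite (fundamental_lt0 G1 tmin_gt0 tmin_le) // normr0 !mul0r.
rewrite ler_wpM2l // ler_expR -subr_ge0 (_ : _ - _ = nu * d * (1 - eps)); last by ring.
by rewrite !mulr_ge0 ?subr_ge0 // ltW.
Qed.

(** Continuous solutions of the full system, with the profile described by its
    outgoing trace Q. The bound D controls the initial data, that is X at time 0
    and Q until the first passage. *)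
Record continuous_full (eps D : R) (X : R -> 'cV[R]_n) (Q : R -> 'cV[R]_m) : Prop :=
  ContinuousFull {
  cf_X : forall T i, {within `[0, T], continuous (fun t : R => X t i 0)};
  cf_Q : forall T i, {within `[0, T], continuous (fun t : R => Q t i 0)};
  cf_ode : forall (t : R) i, 0 < t ->
    is_derive t (1 : R) (fun s => X s i 0) ((A *m X t + B *m Q t) i 0);
  cf_delay : forall (t : R) i, eps * tau i <= t ->
    Q t i 0 = (G1 *m Q (t - eps * tau i) + G2 *m X (t - eps * tau i)) i 0;
  cf_X0 : mxl1 (X 0) <= D;
  cf_Q0 : forall (t : R) i, 0 <= t < eps * tau i -> `|Q t i 0| <= D }.

Section OneSolution.
Variables (eps D : R) (X : R -> 'cV[R]_n) (Q : R -> 'cV[R]_m).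
Hypothesis eps01 : 0 < eps <= 1.
Hypothesis sol : continuous_full eps D X Q.
Variables (T b : R).
Hypothesis T_ge0 : 0 <= T.
Let eta t : 'cV[R]_m := Q t - H *m X t.
Hypothesis b_ge0 : 0 <= b.
Hypothesis eta_le : forall t, 0 <= t <= T -> mxl1 (eta t) <= b * expR (- nu * t).

Lemma deviation_ode (t : R) i : 0 < t ->
  is_derive t (1 : R) (fun s => X s i 0) ((M *m X t + B *m eta t) i 0).
Proof.
move=> t0; have -> : M *m X t + B *m eta t = A *m X t + B *m Q t.
  by rewrite /ros_matrix /eta mulmxDl mulmxBr -!mulmxA addrA addrAC addrK.
exact: (@cf_ode _ _ _ _ sol).
Qed.

Let ca := n%:R * (C + C * mxl1 B / (nu1 - nu)).

(** In terms of the deviation eta = Q - H X, the slow equation is X' = M X + B eta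
    where M is the matrix of the reduced system. *)
Lemma slow_le (t : R) : 0 <= t <= T -> mxl1 (X t) <= ca * (D + b) * expR (- nu * t).
Proof.
move=> /andP[t0 tT]; have D0 := le_trans (mxl1_ge0 _) (cf_X0 sol).
have dn : 0 < nu1 - nu by rewrite subr_gt0.
have B0 := mxl1_ge0 B.
rewrite /ca -!mulrA; apply: mxl1_le_coord => i.
have := @duhamel_bound R n m A B G1 G2 C nu1 C_gt0 ros_decay nu (mxl1 B * b) t X
  (fun s => B *m eta s) nu_lt.
rewrite mulr_ge0 // => /(_ isT t0 (@cf_X _ _ _ _ sol t)) /(_ _ _ i) h.
apply: le_trans (h _ _) _.
- by move=> s j /andP[s0 _]; exact: deviation_ode.
- move=> s /andP[s0 st]; apply: le_trans (enorm_le_mxl1 _) _.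
  apply: le_trans (mxl1M _ _) _; rewrite -mulrA ler_wpM2l //.
  by rewrite eta_le // ltW //= (le_trans (ltW st)).
- rewrite [leRHS]mulrA [leRHS]mulrC ler_wpM2l ?expR_ge0 //.
  have X0 : enorm (X 0) <= D by apply: le_trans (enorm_le_mxl1 _) (cf_X0 sol).
  have C0 := ltW C_gt0.
  have h1 : C * enorm (X 0) <= C * D by rewrite ler_wpM2l.
  have h2 : 0 <= C * b by rewrite mulr_ge0.
  have io : 0 <= (nu1 - nu)^-1 by rewrite invr_ge0 ltW.
  have h3 : 0 <= C * (mxl1 B * (nu1 - nu)^-1) * D by rewrite !mulr_ge0.
  by move: io h3; set io := (nu1 - nu)^-1; lra.
Qed.

Let cv := mxl1 M * ca + mxl1 B.

Lemma slow_speed_le (t : R) i : 0 < t <= T ->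
  `|(M *m X t + B *m eta t) i 0| <= cv * (D + b) * expR (- nu * t).
Proof.
move=> /andP[t0 tT]; have tI : 0 <= t <= T by rewrite (ltW t0).
have D0 := le_trans (mxl1_ge0 _) (cf_X0 sol).
apply: le_trans (le_mxl1 _ i 0) _; apply: le_trans (mxl1D _ _) _.
rewrite /cv !mulrDl; apply: lerD; apply: le_trans (mxl1M _ _) _.
  apply: le_trans (_ : mxl1 M * (ca * (D + b) * expR (- nu * t)) <= _).
    by rewrite ler_wpM2l ?mxl1_ge0 // slow_le.
  by rewrite !mulrA.
apply: le_trans (_ : mxl1 B * (b * expR (- nu * t)) <= _).
  by rewrite ler_wpM2l ?mxl1_ge0 // eta_le.
by rewrite -mulrA ler_wpM2l ?mxl1_ge0 // ler_wpM2r ?expR_ge0 // lerDr.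
Qed.

Lemma ca_ge0 : 0 <= ca.
Proof.
have dn : 0 < nu1 - nu by rewrite subr_gt0.
have C0 := ltW C_gt0; rewrite /ca mulr_ge0 // addr_ge0 //.
by rewrite divr_ge0 ?(ltW dn) // mulr_ge0 ?mxl1_ge0.
Qed.

Lemma cv_ge0 : 0 <= cv.
Proof.
have ca0 := ca_ge0; rewrite /cv addr_ge0 ?mxl1_ge0 //.
by apply: mulr_ge0 => //; exact: mxl1_ge0.
Qed.

Lemma slow_increment_le (s t : R) : 0 <= s <= t -> t <= T ->
  mxl1 (X s - X t) <= n%:R * (cv * (D + b) * expR (- nu * s) * (t - s)).
Proof.
move=> /andP[s0 st] tT; have D0 := le_trans (mxl1_ge0 _) (cf_X0 sol).
set v := cv * (D + b) * expR (- nu * s).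
apply: mxl1_le_coord => i; rewrite !mxE -normrN opprB.
rewrite mulrBr; apply: (@mvt_le _ (fun t => X t i 0) (fun t => v * t)
  (fun t => (M *m X t + B *m eta t) i 0) (fun=> v)) => //.
- apply: continuous_subspaceW (@cf_X _ _ _ _ sol t i) => x /=.
  by rewrite !in_itv /= => /andP[sx ->]; rewrite (le_trans s0).
- apply: continuous_subspaceT => x; apply: cvgM; [exact: cvg_cst | exact: cvg_id].
- by move=> x /andP[sx _]; apply: deviation_ode; exact: le_lt_trans sx.
- move=> x _; have := is_derive_scaler v (is_derive_id x (1 : R)).
  by rewrite mulr1.
- move=> x /andP[sx xt]; apply: le_trans (slow_speed_le _ _) _.
    by rewrite (le_lt_trans s0 sx) (le_trans (ltW xt)).
  rewrite /v ler_wpM2l //; first by rewrite mulr_ge0 ?cv_ge0 // addr_ge0.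
  by rewrite ler_expR !mulNr lerN2; apply: ler_wpM2l; exact: ltW.
Qed.

Let e1 := expR (nu * tmax).
Let h := mxl1 H.
Let c4 := tmax * (h * (n%:R * cv)).

(** The deviation eta satisfies the delay equation of the boundary layer with a
    forcing that is H (X (t - eps tau) - X t) after the first passage. Since X' is
    bounded by X and eta, this increment carries a factor eps: it is the source of
    the small gain. *)
Lemma fast_forcing_le i (t : R) : 0 <= t <= T ->
  (t < eps * tau i -> `|eta t i 0| <= e1 * ((1 + h) * D + eps * c4 * (D + b)) * expR (- nu * t)) /\
  (eps * tau i <= t -> `|(eta t - G1 *m eta (t - eps * tau i)) i 0| <=
     e1 * ((1 + h) * D + eps * c4 * (D + b)) * expR (- nu * t)).
Proof.
move=> /andP[t0 tT]; have D0 := le_trans (mxl1_ge0 _) (cf_X0 sol).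
have [e0 e_1] := andP eps01.
have etm : eps * tau i <= eps * tmax by rewrite ler_wpM2l // ltW.
have eptm : eps * tmax <= tmax by rewrite ler_piMl // ltW.
have cv0 := cv_ge0.
have Db0 : 0 <= D + b by exact: addr_ge0.
have h0 : 0 <= h by exact: mxl1_ge0.
have v0 : 0 <= n%:R * (cv * (D + b)) by rewrite !mulr_ge0.
have incr s : 0 <= s <= t -> t - s <= eps * tmax ->
    h * mxl1 (X s - X t) <= eps * c4 * (D + b) * expR (- nu * s).
  move=> sI ts; apply: le_trans (_ : h * (n%:R * (cv * (D + b) * expR (- nu * s) * (t - s))) <= _).
    by rewrite ler_wpM2l // slow_increment_le.
  apply: le_trans (_ : h * (n%:R * (cv * (D + b) * expR (- nu * s) * (eps * tmax))) <= _).
    do 3!apply: ler_wpM2l => //.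
    by rewrite mulr_ge0 ?expR_ge0 // mulr_ge0.
  by rewrite le_eqVlt /c4; apply/orP; left; apply/eqP; ring.
have c40 : 0 <= c4 by rewrite /c4 mulr_ge0 ?(ltW tmax_gt0) // mulr_ge0 // mulr_ge0.
have ec0 : 0 <= eps * c4 * (D + b) by rewrite mulr_ge0 // mulr_ge0 // ltW.
split=> ti.
  have Q0 : `|Q t i 0| <= D by apply: (cf_Q0 sol); rewrite t0.
  have e1t : 1 <= e1 * expR (- nu * t).
    rewrite /e1 -expRD -expR0 ler_expR; have : t <= tmax by lra.
    by have := nu_gt0; nra.
  apply: (@le_trans _ _ ((1 + h) * D + eps * c4 * (D + b))); last first.
    by rewrite [leRHS]mulrAC ler_peMl // addr_ge0 // mulr_ge0 // addr_ge0.
  have -> : eta t = Q t - (H *m X 0 - H *m (X 0 - X t)) by rewrite -mulmxBr subKr.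
  rewrite !mxsubE.
  have X0 : `|(H *m X 0) i 0| <= h * D.
    apply: le_trans (le_mxl1 _ _ _) _; apply: le_trans (mxl1M _ _) _.
    by rewrite ler_wpM2l // (cf_X0 sol).
  have XD : `|(H *m (X 0 - X t)) i 0| <= eps * c4 * (D + b).
    apply: le_trans (le_mxl1 _ _ _) _; apply: le_trans (mxl1M _ _) _.
    apply: le_trans (incr 0 _ _) _; rewrite ?lexx ?subr0 //; first by lra.
    by rewrite mulr0 expR0 mulr1.
  apply: le_trans (ler_normB _ _) _; apply: le_trans (lerD Q0 (ler_normB _ _)) _.
  by rewrite mulrDl mul1r; lra.
set s := t - eps * tau i.
have HX : H *m X s = G1 *m (H *m X s) + G2 *m X s.
  by rewrite [in RHS]mulmxA -mulmxDl quasi_steadyE.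
have E : eta t - G1 *m eta s =
    H *m (X s - X t) + (Q t - (G1 *m Q s + G2 *m X s)).
  rewrite /eta !mulmxBr {2}HX !opprD opprK.
  by rewrite [RHS](AC (3*(1*2)) ((4*3)*(5*1)*(2*6))) /= subrr addr0.
have s0 : 0 <= s by rewrite subr_ge0.
have sI : 0 <= s <= t by rewrite s0 /= /s lerBlDr lerDl mulr_ge0 ?ltW // ltW.
rewrite E mxaddE mxsubE (cf_delay sol ti) subrr addr0.
apply: le_trans (le_mxl1 _ _ _) _; apply: le_trans (mxl1M _ _) _.
apply: le_trans (incr s sI _) _; first by rewrite /s; lra.
apply: (@le_trans _ _ (e1 * (eps * c4 * (D + b)) * expR (- nu * t))).
  rewrite [leRHS](_ : _ = eps * c4 * (D + b) * (e1 * expR (- nu * t))); last by ring.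
  rewrite ler_wpM2l // /e1 -expRD ler_expR /s.
  by have := nu_gt0; nra.
rewrite ler_wpM2r ?expR_ge0 // ler_wpM2l ?expR_ge0 // lerDr.
by rewrite mulr_ge0 // addr_ge0.
Qed.

(** The time is divided by eps in order to use the delays tau instead of
    eps * tau. *)
Lemma fast_le (t : R) : 0 <= t <= T -> mxl1 (eta t) <=
  m%:R * (m%:R * K2 * (e1 * ((1 + h) * D + eps * c4 * (D + b)))) * expR (- nu * t).
Proof.
move=> /andP[t0 tT]; have [e0 e_1] := andP eps01.
rewrite -mulrA; apply: mxl1_le_coord => i.
pose u i s := if s < 0 then 0 else eta (eps * s) i 0.
pose g i s := u i s - delay_op tau G1 u i s.
have te : t = eps * (t / eps) by rewrite mulrC divfK // gt_eqF.
have te0 : 0 <= t / eps by rewrite divr_ge0 // ltW.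
have -> : eta t i 0 = u i (t / eps) by rewrite /u ltNge te0 /= -te.
have -> : expR (- nu * t) = expR (- (nu * eps) * (t / eps)).
  by rewrite {1}te; congr expR; ring.
apply: (@delay_equation_decay _ _ tau G1 tau_gt0 tmin tmin_gt0 tmin_le K2 (nu * eps) _ u g) => //.
- by move=> N j l; exact: fundamental_sum_eps.
- by move=> l s s0; rewrite /u s0.
- by move=> l s; rewrite /g subrK.
move=> j s /andP[s0 st].
have es : 0 <= eps * s <= T.
  rewrite mulr_ge0 ?(ltW e0) //=; apply: le_trans tT.
  by rewrite [leRHS]te ler_wpM2l // ltW.
have [f1 f2] := fast_forcing_le j es.
rewrite (_ : - (nu * eps) * s = - nu * (eps * s)); last by ring.
rewrite /g /u ltNge s0 /=; have [sj|js] := ltP s (tau j).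
  rewrite /delay_op big1 ?subr0; first by apply: f1; rewrite ltr_pM2l.
  by move=> l _; rewrite subr_lt0 sj mulr0.
have -> : eta (eps * s) j 0 - delay_op tau G1 u j s =
    (eta (eps * s) - G1 *m eta (eps * s - eps * tau j)) j 0.
  rewrite [RHS]mxsubE; congr (_ - _); rewrite [RHS]mxE; apply: eq_bigr => l _.
  by rewrite /u ltNge subr_ge0 js /= mulrBr.
by apply: f2; rewrite ler_pM2l.
Qed.

End OneSolution.

Let H1 := mxl1 H.
Let ca := n%:R * (C + C * mxl1 B / (nu1 - nu)).
Let c4 := tmax * (H1 * (n%:R * (mxl1 M * ca + mxl1 B))).
Let c3 := m%:R * (m%:R * K2 * expR (nu * tmax)).

(** Let b be the largest weighted deviation exp(nu t) |eta t| on [0, T]. The slow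
    equation bounds X by D + b, and the delay equation bounds b by
    D + eps (D + b) up to constants. For small eps the last term is absorbed,
    uniformly in T. *)
Theorem small_gain : exists eps_star K : R, [/\ 0 < eps_star, 0 < K &
  forall eps D X Q, 0 < eps <= eps_star -> continuous_full eps D X Q ->
  forall t, 0 <= t -> mxl1 (X t) + mxl1 (Q t) <= K * expR (- nu * t) * D].
Proof.
have H0 : 0 <= H1 by exact: mxl1_ge0.
have ca0 : 0 <= ca.
  rewrite /ca mulr_ge0 // addr_ge0 ?(ltW C_gt0) // divr_ge0 ?subr_ge0 ?(ltW nu_lt) //.
  by rewrite mulr_ge0 ?mxl1_ge0 // ltW.
have c40 : 0 <= c4.
  rewrite /c4 mulr_ge0 ?(ltW tmax_gt0) // mulr_ge0 // mulr_ge0 // addr_ge0 ?mxl1_ge0 //.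
  by apply: mulr_ge0 => //; exact: mxl1_ge0.
have c30 : 0 <= c3 by rewrite /c3 mulr_ge0 // mulr_ge0 ?expR_ge0 // mulr_ge0.
have c34 : 0 <= c3 * c4 by exact: mulr_ge0.
have q0 : 0 < 2 * (c3 * c4) + 1 by lra.
pose bb := 2 * c3 * (1 + H1) + 1.
have bb0 : 0 <= bb.
  by rewrite /bb addr_ge0 // mulr_ge0 ?addr_ge0 // mulr_ge0.
exists (Num.min 1 (2 * (c3 * c4) + 1)^-1), (bb + (1 + H1) * (ca * (1 + bb)) + 1); split.
- by rewrite lt_min ltr01 invr_gt0.
- have : 0 <= (1 + H1) * (ca * (1 + bb)).
    by rewrite mulr_ge0 ?addr_ge0 // mulr_ge0 // addr_ge0.
  lra.
move=> eps D X Q /andP[e0]; rewrite le_min => /andP[e_1 e_s] sol T T0.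
have eps01 : 0 < eps <= 1 by rewrite e0.
have D0 := le_trans (mxl1_ge0 _) (cf_X0 sol).
have ec : eps * (c3 * c4) <= 2^-1.
  have : eps * (2 * (c3 * c4) + 1) <= 1 by rewrite -ler_pdivlMr // mul1r.
  by lra.
pose eta t : 'cV[R]_m := Q t - H *m X t.
(* weighted deviation; its maximum over [0, T] is attained *)
pose w t := expR (nu * t) * mxl1 (eta t).
have cw : {within `[0, T], continuous w}.
  move=> x; apply: cvgM.
    have := @continuous_subspaceT _ _ `[0, T]%classic (fun s => expR (nu * s)) _ x.
    by apply; exact: continuous_expR_lin.
  rewrite /mxl1; apply: cvg_big => [|i _]; first exact: add_continuous.
  apply: cvg_big => [|j _]; first exact: add_continuous.
  apply: cvg_norm; rewrite (ord1 j).
  have -> : (fun x => eta x i 0) = (fun x => Q x i 0 - \sum_l H i l * X x l 0).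
    by apply/funext => s; rewrite mxsubE; congr (_ - _); rewrite mxE.
  rewrite mxsubE [X in _ --> _ - X]mxE.
  apply: cvgB; first exact: (@cf_Q _ _ _ _ sol).
  apply: cvg_big => [|l _]; first exact: add_continuous.
  by apply: cvgM; [exact: cvg_cst | exact: (@cf_X _ _ _ _ sol)].
have [ts tsI Hts] := EVT_max T0 cw.
have {}tsI : 0 <= ts <= T by move: tsI; rewrite in_itv.
pose b := w ts.
have b0 : 0 <= b by rewrite /b /w mulr_ge0 ?expR_ge0 ?mxl1_ge0.
have eta_le t : 0 <= t <= T -> mxl1 (eta t) <= b * expR (- nu * t).
  move=> tI; have := Hts t; rewrite in_itv /= => /(_ tI); rewrite -/b /w => h.
  rewrite mulNr expRN ler_pdivlMr ?expR_gt0 // mulrC //.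
have bbD : b <= bb * D.
  have := fast_le eps01 sol b0 eta_le tsI.
  rewrite -/eta mulNr expRN ler_pdivlMr ?expR_gt0 // mulrC -/(w ts) -/b => h.
  have {}h : b <= c3 * ((1 + H1) * D) + eps * (c3 * c4) * (D + b).
    by apply: le_trans h _; rewrite le_eqVlt; apply/orP; left; apply/eqP; rewrite /c3 /c4 /ca /H1; ring.
  have : eps * (c3 * c4) * (D + b) <= 2^-1 * (D + b).
    by rewrite ler_wpM2r // addr_ge0.
  by rewrite /bb; lra.
have TI : 0 <= T <= T by rewrite T0 lexx.
have XT := slow_le sol b0 eta_le TI.
have etaT := eta_le T TI.
have QT : mxl1 (Q T) <= mxl1 (eta T) + H1 * mxl1 (X T).
  rewrite -[Q T](subrK (H *m X T)); apply: le_trans (mxl1D _ _) _.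
  by rewrite lerD2l mxl1M.
set e := expR (- nu * T) in XT etaT *.
have ege : 0 <= e by exact: expR_ge0.
have XT' : mxl1 (X T) <= ca * ((1 + bb) * D) * e.
  apply: le_trans XT _; rewrite ler_wpM2r // ler_wpM2l // mulrDl mul1r lerD2l //.
have eT' : mxl1 (eta T) <= bb * D * e by apply: le_trans etaT _; rewrite ler_wpM2r.
have HXT : H1 * mxl1 (X T) <= H1 * (ca * ((1 + bb) * D) * e) by rewrite ler_wpM2l.
have De : 0 <= D * e by exact: mulr_ge0.
have -> : (bb + (1 + H1) * (ca * (1 + bb)) + 1) * e * D =
  bb * D * e + (ca * ((1 + bb) * D) * e + H1 * (ca * ((1 + bb) * D) * e)) + D * e by ring.
lra.
Qed.

End SmallGain.

(** * The outgoing trace of a solution of the full system *)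

Section Trace.
Variables (R : realType) (n m : nat).
Variables (lam : 'rV[R]_m) (A : 'M[R]_n) (B : 'M[R]_(n, m)).
Variables (G1 : 'M[R]_m) (G2 : 'M[R]_(m, n)).
Hypothesis lam_gt0 : forall i, 0 < lam 0 i.
Let tau i := (lam 0 i)^-1.
Let tau_gt0 i : 0 < tau i. Proof. by rewrite invr_gt0. Qed.

Local Notation I01 := (`]0, 1[%classic : set R).
Local Notation leb := (@lebesgue_measure R).

Variables (eps : R) (p : \bar R) (p1 : (1 <= p)%E).
Variables (z0 : 'cV[R]_n) (y0 : R -> 'cV[R]_m) (z : R -> 'cV[R]_n) (y : R -> R -> 'cV[R]_m).
Hypothesis eps_gt0 : 0 < eps.
Hypothesis sol : full_solution lam A B G1 G2 eps (Lebesgue_space p1) z0 y0 z y.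

(** The outgoing values y_i(1, t), set to 0 for t <= 0. With this convention the
    trace satisfies the delay equation at all times but one, t = eps tau i, where the
    boundary value y(0, 0) enters, about which the equations say nothing. *)
Definition trace (i : 'I_m) (t : R) : R := if t <= 0 then 0 else y 1 t i 0.

Let te i := eps * tau i.
Let te_gt0 i : 0 < te i. Proof. exact: mulr_gt0. Qed.

(** Each value of the profile reaches the outgoing boundary later, also those that
    come from the initial condition. *)
Lemma traceE i x t : 0 <= x < 1 -> 0 <= t -> y x t i 0 = trace i (t + te i * (1 - x)).
Proof.
move=> /andP[x0 x1] t0.
have s0 : 0 < te i * (1 - x) by rewrite mulr_gt0 // subr_gt0.
have ts : 0 < t + te i * (1 - x) by lra.
have tr := full_transport sol.
rewrite /trace leNgt ts /= (tr i x t) ?x0 ?(ltW x1) // (tr i 1) ?ler01 ?lexx ?(ltW ts) //.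
have ex w : eps * w / lam 0 i = te i * w by rewrite /te /tau; ring.
rewrite !ex mulr1 (_ : (te i <= t + te i * (1 - x)) = (te i * x <= t)); last first.
  by apply/idP/idP; lra.
case: ifP => _.
  by congr (y _ _ _ _); ring.
congr (y0 _ _ _); rewrite /te /tau; field.
by rewrite !gt_eqF.
Qed.

Lemma trace_data i t : 0 < t < te i -> trace i t = y0 (1 - t / te i) i 0.
Proof.
move=> /andP[t0 tt]; have tr := full_transport sol.
rewrite /trace leNgt t0 /= (tr i 1) ?ler01 ?lexx ?(ltW t0) // mulr1 -/(te i) ifF; last by apply/negbTE; rewrite -ltNge.
by congr (y0 _ _ _); rewrite /te /tau; field; rewrite !gt_eqF.
Qed.

Lemma trace_delay i t : te i < t ->
  trace i t = \sum_j G1 i j * trace j (t - te i) + \sum_k G2 i k * z (t - te i) k 0.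
Proof.
move=> tt; have t0 : 0 < t by apply: lt_trans tt.
have s0 : 0 < t - te i by rewrite subr_gt0.
have tr := full_transport sol.
rewrite {1}/trace leNgt t0 /= (tr i 1) ?ler01 ?lexx ?(ltW t0) // mulr1 -/(te i) ifT ?(ltW tt) // (full_boundary sol) // !mxE.
by congr (_ + _); apply: eq_bigr => j _; rewrite /trace leNgt s0.
Qed.

Let win i t : set R := `]t, t + te i[%classic.

Lemma trace_window i t : 0 <= t ->
  (trace i) \_ (win i t) =
  (fun s => ((fun x => y x t i 0) \_ I01) (- (te i)^-1 * s + (1 + t / te i))).
Proof.
move=> t0; apply/funext => s.
have tn : te i != 0 by rewrite gt_eqF.
have e : - (te i)^-1 * s + (1 + t / te i) = 1 - (s - t) / te i by field.
have inI : (s \in win i t) = (- (te i)^-1 * s + (1 + t / te i) \in I01).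
  rewrite e /win; apply/idP/idP; rewrite !inE /= !in_itv /= => /andP[h1 h2].
    have : 0 < (s - t) / te i by rewrite divr_gt0 // subr_gt0.
    have : (s - t) / te i < 1 by rewrite ltr_pdivrMr // mul1r; lra.
    by lra.
  have : 0 < (s - t) / te i by lra.
  have : (s - t) / te i < 1 by lra.
  by rewrite ltr_pdivrMr // mul1r pmulr_lgt0 ?invr_gt0 //; lra.
rewrite !patchE inI; case: ifP => //; rewrite e inE /= in_itv /= => /andP[h1 h2].
rewrite traceE //; last by rewrite (ltW h1).
by congr trace; field.
Qed.

Lemma y_coord_measurable i t : 0 <= t -> measurable_fun I01 (fun x => y x t i 0).
Proof. by move=> t0; exact: (full_in_space sol t0).1. Qed.

Lemma y_coord_lnorm1 i t : 0 <= t ->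
  (lnorm 1 (fun x => y x t i 0)%R <= space_norm (Lebesgue_space p1) (y ^~ t))%E.
Proof.
move=> t0; apply: le_trans (lnorm1_le p1 _) (lnorm_coord_le p1 i _).
  exact: y_coord_measurable.
by move=> j; exact: y_coord_measurable.
Qed.

Lemma trace_window_measurable i t : 0 <= t -> measurable_fun setT ((trace i) \_ (win i t)).
Proof.
move=> t0; rewrite trace_window //.
apply: (measurableT_comp (measurable_patch01 (y_coord_measurable i t0))).
exact: measurable_affine.
Qed.

Lemma trace_window_integral i t : 0 <= t ->
  (\int[leb]_s `|((trace i) \_ (win i t)) s|%:E =
   (te i)%:E * lnorm 1 (fun x => y x t i 0)%R)%E.
Proof.
move=> t0; rewrite trace_window //.
have mF := measurable_patch01 (y_coord_measurable i t0).
have a0 : - (te i)^-1 != 0 by rewrite oppr_eq0 invr_eq0 gt_eqF.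
have := @ge0_integral_affine R (- (te i)^-1) (1 + t / te i)
  (fun x => `|((fun x => y x t i 0) \_ I01) x|%:E) a0.
rewrite normrN normfV invrK gtr0_norm // => -> //; last first.
  by apply/measurable_EFinP; exact: measurableT_comp.
congr (_ * _)%E; rewrite /lnorm Lnorm1 -integral_lebesgue01 // => x nx.
rewrite patchE ifF ?normr0 //; apply/negbTE/negP => /set_mem /=.
by rewrite in_itv.
Qed.

Let half i := te i / 2.
Let half_gt0 i : 0 < half i. Proof. exact: divr_gt0. Qed.

(** Windows of length te i starting at the multiples of half this length cover the
    positive times. Measurability and integrability of the trace are known
    on windows, where the trace is an affine image of one profile. *)
Lemma window_cover i s : 0 < s ->
  exists2 k : nat, k%:R * half i <= s & win i (k%:R * half i) s.
Proof.
move=> s0; have sh : 0 <= s / half i by rewrite divr_ge0 // ltW.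
have hlt := half_gt0 i.
have := truncn_itv sh; set j := Num.truncn _ => /andP[].
rewrite ler_pdivlMr // ltr_pdivrMr // => j1 j2.
have t2 : te i = half i + half i by rewrite /half; field.
case: (posnP j) => [j0|jpos].
  exists 0%N; first by rewrite mul0r ltW.
  rewrite /win /= in_itv /= mul0r s0 add0r t2; move: j2; rewrite j0 mul1r; lra.
move: j1 j2; rewrite -(prednK jpos) -!natr1 !mulrDl !mul1r => j1 j2.
exists j.-1; first by lra.
by rewrite /win /= in_itv /= t2; apply/andP; split; lra.
Qed.

Lemma trace_measurable i : measurable_fun (setT : set R) (trace i).
Proof.
have -> : (setT : set R) = `]-oo, 0] `|` \bigcup_(k : nat) win i (k%:R * half i).
  apply/seteqP; split => // s _; have [s0|s0] := leP s 0.
    by left; rewrite /= in_itv.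
  by right; have [k _ kw] := window_cover i s0; exists k.
apply/measurable_funU => //; first by apply: bigcup_measurable => k _; exact: measurable_itv.
split.
  apply/(measurable_restrictT (trace i)) => //.
  rewrite (_ : _ \_ _ = cst 0); first exact: measurable_cst.
  apply/funext => s; rewrite patchE; case: ifPn => //.
  by rewrite inE /= in_itv /= => s0; rewrite /trace s0.
apply/measurable_fun_bigcup => [k|k]; first exact: measurable_itv.
apply/(measurable_restrictT (trace i)); first exact: measurable_itv.
by apply: trace_window_measurable; rewrite mulr_ge0 // ltW.
Qed.

Lemma trace_integrable i T : leb.-integrable `[0, T] (EFin \o trace i).
Proof.
apply/integrableP; split.
  by apply/measurable_EFinP; apply: measurable_funTS; exact: trace_measurable.
have [N TN] := archi_bound_mul T (half_gt0 i).
pose F k s : \bar R := `|((trace i) \_ (win i (k%:R * half i))) s|%:E.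
have F0 k s : (0 <= F k s)%E by rewrite /F lee_fin.
have k0 (k : nat) : 0 <= k%:R * half i by rewrite mulr_ge0 // ltW.
have mF k : measurable_fun setT (F k).
  by apply/measurable_EFinP; apply: measurableT_comp => //; exact: trace_window_measurable.
rewrite integral_mkcond; apply: (@le_lt_trans _ _ (\int[leb]_s (\sum_(k < N) F k s))%E).
  apply: ge0_le_integral => //.
  - by move=> s _; rewrite patchE; case: ifP.
  - apply/(measurable_restrictT (abse \o (EFin \o trace i))) => //.
    apply: measurable_funTS; apply: measurableT_comp => //.
    by apply/measurable_EFinP; exact: trace_measurable.
  - by apply: emeasurable_sum => k; exact: mF.
  - move=> s _; rewrite patchE; case: ifPn => [|_]; last by apply: sume_ge0 => k _; exact: F0.
    rewrite inE /= in_itv /= => /andP[s0 sT].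
    have [s00|sp] := leP s 0.
      by rewrite /trace s00 normr0; apply: sume_ge0 => k _; exact: F0.
    have [k ks kw] := window_cover i sp.
    have kN : (k < N)%N.
      rewrite -(ltr_nat R) -(ltr_pM2r (half_gt0 i)); apply: le_lt_trans TN.
      exact: le_trans ks sT.
    rewrite (bigD1 (Ordinal kN)) //= /F patchE mem_set //=.
    by rewrite leeDl //; apply: sume_ge0 => l _; exact: F0.
rewrite ge0_integral_sum //; last by move=> k; exact: mF.
apply: (big_ind (fun x => (x < +oo)%E)) => // [a b|k _]; first exact: lte_add_pinfty.
rewrite /F trace_window_integral // lte_mul_pinfty ?lee_fin ?(ltW (te_gt0 i)) //.
by apply: le_lt_trans (y_coord_lnorm1 i _) _ => //; exact: (full_in_space sol (k0 k)).2.
Qed.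

End Trace.

(** * Primitives of solutions *)

Section IntegralTools.
Variable R : realType.
Local Notation leb := (@lebesgue_measure R).

Lemma integral_shift (f : R -> \bar R) (b : R) : measurable_fun setT f ->
  (\int[leb]_x f (x + b)%R = \int[leb]_x f x)%E.
Proof.
move=> mf; have ge0 (h : R -> \bar R) : measurable_fun setT h -> (forall x, 0 <= h x)%E ->
    (\int[leb]_x h (x + b)%R = \int[leb]_x h x)%E.
  move=> mh h0; have := ge0_integral_affine b (oner_neq0 R) mh h0.
  rewrite normr1 invr1 mul1e => <-.
  by apply: eq_integral => x _; rewrite mul1r.
rewrite integralE [RHS]integralE; congr (_ - _)%E.
  have h := ge0 _ (measurable_funepos mf) (fun x => funepos_ge0 f x).
  by apply: etrans h; apply: eq_integral => x _; rewrite !funeposE.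
have h := ge0 _ (measurable_funeneg mf) (fun x => funeneg_ge0 f x).
by apply: etrans h; apply: eq_integral => x _; rewrite !funenegE.
Qed.

Lemma Rintegral_shift (g : R -> R) (c t : R) : measurable_fun setT g ->
  \int[leb]_(s in `]c, t]) g (s - c) = \int[leb]_(s in `]0, t - c]) g s.
Proof.
move=> mg; rewrite Rintegral_mkcond [RHS]Rintegral_mkcond /Rintegral; congr fine.
rewrite -[RHS](integral_shift (- c)).
  apply: eq_integral => s _; congr EFin; rewrite !patchE.
  rewrite (_ : (s \in `]c, t]%classic) = (s - c \in `]0, t - c]%classic)) //.
  by apply/idP/idP; rewrite !inE /= !in_itv /= => /andP[h1 h2]; lra.
apply/measurable_EFinP; apply/(measurable_restrictT g) => //.
exact: measurable_funTS.
Qed.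

Lemma integrable_lincomb (D : set R) k (c : 'I_k -> R) (f : 'I_k -> R -> R) :
  measurable D -> (forall i, leb.-integrable D (EFin \o f i)) ->
  leb.-integrable D (EFin \o (fun s => \sum_i c i * f i s)).
Proof.
move=> mD H.
have -> : EFin \o (fun s => \sum_i c i * f i s) = (fun s => \sum_i (c i)%:E * (f i s)%:E)%E.
  by apply/funext => s /=; rewrite -sumEFin.
by apply: integrable_sum => // i _; apply: integrableZl => //; exact: H.
Qed.

Lemma Rintegral_lincomb (D : set R) k (c : 'I_k -> R) (f : 'I_k -> R -> R) :
  measurable D -> (forall i, leb.-integrable D (EFin \o f i)) ->
  \int[leb]_(s in D) (\sum_i c i * f i s) = \sum_i c i * \int[leb]_(s in D) f i s.
Proof.
elim: k c f => [|k IH] c f mD H.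
  rewrite big_ord0; under eq_Rintegral do rewrite big_ord0.
  by rewrite Rintegral_cst // mul0r.
rewrite big_ord_recl -IH //.
under eq_Rintegral do rewrite big_ord_recl.
rewrite RintegralD //; first by rewrite RintegralZl.
  rewrite (_ : _ \o _ = (fun s => (c ord0)%:E * (f ord0 s)%:E)%E) //.
  by apply: integrableZl => //; exact: H.
by apply: integrable_lincomb.
Qed.

Lemma integrable_addr (D : set R) (f g : R -> R) : measurable D ->
  leb.-integrable D (EFin \o f) -> leb.-integrable D (EFin \o g) ->
  leb.-integrable D (EFin \o (fun s => f s + g s)).
Proof.
move=> mD fi gi.
by rewrite (_ : _ \o _ = (fun s => (EFin \o f) s + (EFin \o g) s)%E) //; exact: integrableD.
Qed.

Lemma within_negative (f : R -> R) T : T < 0 -> {within `[0, T], continuous f}.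
Proof.
move=> T0; rewrite set_itv_ge; first exact: continuous_subspace0.
by rewrite bnd_simp -ltNge.
Qed.

End IntegralTools.

Section Primitives.
Variables (R : realType) (n m : nat).
Variables (lam : 'rV[R]_m) (A : 'M[R]_n) (B : 'M[R]_(n, m)).
Variables (G1 : 'M[R]_m) (G2 : 'M[R]_(m, n)).
Hypothesis lam_gt0 : forall i, 0 < lam 0 i.
Let tau i := (lam 0 i)^-1.
Let tau_gt0 i : 0 < tau i. Proof. by rewrite invr_gt0. Qed.

Local Notation I01 := (`]0, 1[%classic : set R).
Local Notation leb := (@lebesgue_measure R).

Variables (eps : R) (p : \bar R) (p1 : (1 <= p)%E).
Variables (z0 : 'cV[R]_n) (y0 : R -> 'cV[R]_m) (z : R -> 'cV[R]_n) (y : R -> R -> 'cV[R]_m).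
Hypothesis eps_gt0 : 0 < eps.
Hypothesis sol : full_solution lam A B G1 G2 eps (Lebesgue_space p1) z0 y0 z y.
Hypothesis y0_space : in_space (Lebesgue_space p1) y0.

Let te i := eps * tau i.
Let te_gt0 i : 0 < te i. Proof. exact: mulr_gt0. Qed.

Definition zint (t : R) : 'cV[R]_n := \col_k \int[leb]_(s in `[0, t]) z s k 0.
Definition uint (t : R) : 'cV[R]_m := \col_i \int[leb]_(s in `[0, t]) trace y i s.

Lemma primitive_continuous (f : R -> R) T :
  (0 <= T -> leb.-integrable `[0, T] (EFin \o f)) ->
  {within `[0, T], continuous (fun t => \int[leb]_(s in `[0, t]) f s)}.
Proof.
move=> fi; have [T0|T0] := leP 0 T; last exact: within_negative.
exact: parameterized_integral_continuous T0 (fi T0).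
Qed.

Lemma z_continuous k T : {within `[0, T], continuous (fun t : R => z t k 0)}.
Proof.
pose F t := z0 k 0 + \int[leb]_(s in `[0, t]) ((A *m z s + B *m y 1 s) k 0).
have zF x : x \in (`[0, T]%classic : set R) -> F x = z x k 0.
  by rewrite inE /= in_itv /= => /andP[x0 _]; rewrite (full_ode sol).
apply: (subspace_eq_continuous zF) => x; apply: cvgD; first exact: cvg_cst.
by apply: primitive_continuous => T0; exact: (full_integrable sol).
Qed.

Lemma z_integrable k T : leb.-integrable `[0, T] (EFin \o (fun t : R => z t k 0)).
Proof.
apply: continuous_compact_integrable; first exact: segment_compact.
exact: z_continuous.
Qed.

Lemma zint_continuous T k : {within `[0, T], continuous (fun t : R => zint t k 0)}.
Proof.
have -> : (fun t : R => zint t k 0) = (fun t => \int[leb]_(s in `[0, t]) z s k 0).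
  by apply/funext => t; rewrite mxE.
by apply: primitive_continuous => _; exact: z_integrable.
Qed.

Lemma uint_continuous T i : {within `[0, T], continuous (fun t : R => uint t i 0)}.
Proof.
have -> : (fun t : R => uint t i 0) = (fun t => \int[leb]_(s in `[0, t]) trace y i s).
  by apply/funext => t; rewrite mxE.
by apply: primitive_continuous => _; exact: (trace_integrable lam_gt0 eps_gt0 sol i T).
Qed.

Lemma zint_derive (t : R) k : 0 < t -> is_derive t (1 : R) (fun s => zint s k 0) (z t k 0).
Proof.
move=> t0; have -> : (fun t : R => zint t k 0) = (fun t => \int[leb]_(s in `[0, t]) z s k 0).
  by apply/funext => s; rewrite mxE.
have tt1 : t < t + 1 by rewrite ltrDl.
have T1 : 0 < t + 1 by lra.
have cz : {for t, continuous (fun s : R => z s k 0)}.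
  have [+ _ _] := (continuous_within_itvP _ T1).1 (@z_continuous k (t + 1)).
  by apply; rewrite in_itv /= t0.
have [d1 d2] := continuous_FTC1_closed tt1 (z_integrable k (t + 1)) t0 cz.
by split; [exact: d1 | rewrite -derive1E].
Qed.

Lemma z_zint t : 0 <= t -> z t = z0 + (A *m zint t + B *m uint t).
Proof.
move=> t0; apply/matrixP => i j; rewrite (ord1 j) (full_ode sol) // !mxE; congr (_ + _).
pose f s := \sum_k A i k * z s k 0 + \sum_l B i l * trace y l s.
have ti l : leb.-integrable `[0, t] (EFin \o trace y l) by exact: (trace_integrable lam_gt0 eps_gt0 sol l t).
have i1 : leb.-integrable `[0, t] (EFin \o (fun s => \sum_k A i k * z s k 0)).
  by apply: integrable_lincomb => // k; exact: z_integrable.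
have i2 : leb.-integrable `[0, t] (EFin \o (fun s => \sum_l B i l * trace y l s)).
  by apply: integrable_lincomb.
have fi : leb.-integrable `[0, t] (EFin \o f) by apply: integrable_addr.
have oc (h : R -> R) : leb.-integrable `[0, t] (EFin \o h) ->
    \int[leb]_(s in `[0, t]) h s = \int[leb]_(s in `]0, t]) h s.
  move=> hi; rewrite Rintegral_itv_obnd_cbnd //.
  by apply: integrableS hi => // x /=; rewrite !in_itv /= => /andP[/ltW -> ->].
rewrite oc; last exact: (full_integrable sol).
transitivity (\int[leb]_(s in `]0, t]) f s).
  apply: eq_Rintegral => s; rewrite inE /= in_itv /= => /andP[s0 _].
  rewrite !mxE /f; congr (_ + _); apply: eq_bigr => l _.
  by rewrite /trace leNgt s0.
rewrite -oc // RintegralD // !Rintegral_lincomb //; last by move=> k; exact: z_integrable.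
by congr (_ + _); apply: eq_bigr => k _; rewrite mxE.
Qed.

Lemma z_measurable k : measurable_fun (setT : set R) (fun s : R => if s <= 0 then 0 else z s k 0).
Proof.
have -> : (setT : set R) = `]-oo, 0] `|` \bigcup_(N : nat) (`]0, N%:R]%classic : set R).
  apply/seteqP; split => // s _; have [s0|s0] := leP s 0.
    by left; rewrite /= in_itv.
  right; have [N sN] := archi_bound_mul s (@ltr01 R).
  by exists N => //=; rewrite in_itv /= s0 ltW // -[N%:R]mulr1.
apply/measurable_funU => //; first by apply: bigcup_measurable => N _; exact: measurable_itv.
split.
  apply/(measurable_restrictT (fun s : R => if s <= 0 then 0 else z s k 0)) => //.
  rewrite (_ : _ \_ _ = cst 0); first exact: measurable_cst.
  apply/funext => s; rewrite patchE; case: ifPn => //.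
  by rewrite inE /= in_itv /= => ->.
apply/measurable_fun_bigcup => [N|N]; first exact: measurable_itv.
have [/measurable_EFinP mz _] := integrableP _ _ _ (z_integrable k N%:R).
have mz' : measurable_fun (`]0, N%:R]%classic : set R) (fun s : R => z s k 0).
  by apply: measurable_funS mz => // x /=; rewrite !in_itv /= => /andP[/ltW -> ->].
apply/(measurable_restrictT (fun s : R => if s <= 0 then 0 else z s k 0)) => //.
rewrite (_ : _ \_ _ = (fun s : R => z s k 0) \_ `]0, N%:R]%classic).
  by apply/(measurable_restrictT (fun s : R => z s k 0)).
apply/funext => s; rewrite !patchE; case: ifPn => //.
by rewrite inE /= in_itv /= => /andP[s0 _]; rewrite leNgt s0.
Qed.

(** The delay relation holds for the primitives up to the constant uint (te i),
    which collects the initial profile. *)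
Lemma uint_delay (t : R) i : te i <= t ->
  uint t i 0 = uint (te i) i 0 + (G1 *m uint (t - te i) + G2 *m zint (t - te i)) i 0.
Proof.
move=> tt; have t0 : 0 <= t by apply: le_trans tt; exact: ltW.
have ti l T : leb.-integrable `[0, T] (EFin \o trace y l) by exact: (trace_integrable lam_gt0 eps_gt0 sol l T).
rewrite ![uint _ i 0]mxE.
have := @Rintegral_itvB R (trace y i) (BLeft 0) (BRight t) (te i) (ti i t).
rewrite !bnd_simp => /(_ (ltW (te_gt0 i)) tt) e.
rewrite -[LHS](subrK (\int[leb]_(s in `[0, te i]) trace y i s)) addrC e; congr (_ + _).
pose zc k s := if s <= 0 then 0 else z s k 0.
pose f s := \sum_l G1 i l * trace y l s + \sum_k G2 i k * zc k s.
transitivity (\int[leb]_(s in `]te i, t]) f (s - te i)).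
  apply: eq_Rintegral => s; rewrite inE /= in_itv /= => /andP[s1 s2].
  rewrite (trace_delay lam_gt0 eps_gt0 sol) // /f; congr (_ + _).
  by apply: eq_bigr => k _; rewrite /zc leNgt subr_gt0 s1.
rewrite Rintegral_shift; last first.
  apply: measurable_funD; apply: measurable_sum => l; apply: measurable_funM => //.
    exact: (trace_measurable lam_gt0 eps_gt0 sol l).
  exact: z_measurable.
have sub (h : R -> R) : leb.-integrable `[0, t - te i] (EFin \o h) ->
    leb.-integrable `]0, t - te i] (EFin \o h).
  by apply: integrableS => // x /=; rewrite !in_itv /= => /andP[/ltW -> ->].
transitivity (\int[leb]_(s in `]0, t - te i]) (\sum_l G1 i l * trace y l s + \sum_k G2 i k * z s k 0)).
  apply: eq_Rintegral => s; rewrite inE /= in_itv /= => /andP[s1 s2].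
  by rewrite /f; congr (_ + _); apply: eq_bigr => k _; rewrite /zc leNgt s1.
have i1 : leb.-integrable `]0, t - te i] (EFin \o (fun s => \sum_l G1 i l * trace y l s)).
  by apply: sub; apply: integrable_lincomb.
have i2 : leb.-integrable `]0, t - te i] (EFin \o (fun s => \sum_k G2 i k * z s k 0)).
  by apply: sub; apply: integrable_lincomb => // k; exact: z_integrable.
rewrite RintegralD // !mxE; congr (_ + _); rewrite Rintegral_lincomb //.
- by apply: eq_bigr => l _; rewrite mxE Rintegral_itv_obnd_cbnd //; exact: sub.
- by move=> l; exact: sub.
- apply: eq_bigr => k _; rewrite mxE Rintegral_itv_obnd_cbnd //.
  by apply: sub; exact: z_integrable.
- by move=> k; apply: sub; exact: z_integrable.
Qed.

(** Before the first passage the trace is the initial profile read backwards, so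
    its integral is at most te i times the L^1 norm of y0, hence times its L^p norm. *)
Lemma uint_initial_le (t : R) i : 0 <= t <= te i ->
  `|uint t i 0| <= te i * fine (space_norm (Lebesgue_space p1) y0).
Proof.
move=> /andP[t0 tt]; rewrite mxE.
have ti : leb.-integrable `[0, t] (EFin \o trace y i) by exact: (trace_integrable lam_gt0 eps_gt0 sol i t).
apply: le_trans (le_normr_Rintegral _ ti) _ => //.
have Nfin : space_norm (Lebesgue_space p1) y0 \is a fin_num.
  rewrite ge0_fin_numE; first exact: y0_space.2.
  exact: Lnorm_ge0.
have h : (\int[leb]_(s in `[0%R, t]) `|trace y i s|%:E <=
    (te i)%:E * space_norm (Lebesgue_space p1) y0)%E.
  apply: (@le_trans _ _ ((te i)%:E * lnorm 1 (fun x => y x 0 i 0)%R)%E); last first.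
    apply: lee_wpmul2l; first by rewrite lee_fin ltW.
    have -> : lnorm 1 (fun x => y x 0 i 0)%R = lnorm 1 (fun x => y0 x i 0)%R.
      apply: eq_Lnorm => x; rewrite !patchE; case: ifPn => //.
      rewrite inE /= in_itv /= => /andP[x0 x1].
      rewrite (full_transport sol) ?lexx ?(ltW x0) ?(ltW x1) // ifF.
        by rewrite mulr0 mul0r subr0.
      by apply/negbTE; rewrite -ltNge divr_gt0 // mulr_gt0.
    apply: le_trans (lnorm1_le p1 _) (lnorm_coord_le p1 i _); first exact: y0_space.1.
    exact: y0_space.1.
  rewrite -(trace_window_integral lam_gt0 eps_gt0 sol i (lexx 0)) integral_mkcond.
  have mt : measurable_fun setT (fun s => `|trace y i s|%:E).
    apply/measurable_EFinP; apply: measurableT_comp => //.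
    exact: (trace_measurable lam_gt0 eps_gt0 sol i).
  apply: ae_ge0_le_integral => //.
  - by move=> s _; rewrite patchE; case: ifP.
  - by apply/(measurable_restrictT (fun s => `|trace y i s|%:E)) => //; exact: measurable_funTS.
  - apply/measurable_EFinP; apply: measurableT_comp => //.
    exact: (trace_window_measurable lam_gt0 eps_gt0 sol i (lexx 0)).
  - exists [set te i]; split => //; first exact: lebesgue_measure_set1.
    move=> s /= ns; apply: contrapT => /eqP ste; apply: ns => _.
    rewrite !patchE; case: ifPn => [|_]; last by rewrite lee_fin.
    rewrite inE /= in_itv /= => /andP[s0 st].
    have [s00|sp] := leP s 0; first by rewrite /trace s00 normr0 lee_fin.
    rewrite mem_set ?lexx //= in_itv /= add0r sp lt_def eq_sym ste /=.
    exact: le_trans st tt.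
have Ifin : (\int[leb]_(s in `[0%R, t]) `|trace y i s|%:E)%E \is a fin_num.
  have [_ fi] := integrableP _ _ _ ti.
  by rewrite ge0_fin_numE //; apply: integral_ge0.
by rewrite /Rintegral -lee_fin EFinM !fineK.
Qed.

End Primitives.

(** * Decay of the slow variable *)

Section SlowDecay.
Variables (R : realType) (n m : nat) (lam : 'rV[R]_m).
Variables (A : 'M[R]_n) (B : 'M[R]_(n, m)) (G1 : 'M[R]_m) (G2 : 'M[R]_(m, n)).
Hypothesis lam_gt0 : forall i, 0 < lam 0 i.
Let tau i := (lam 0 i)^-1.
Let tau_gt0 i : 0 < tau i. Proof. by rewrite invr_gt0. Qed.
Variables tmin tmax : R.
Hypothesis tmin_gt0 : 0 < tmin.
Hypothesis tmin_le : forall i, tmin <= tau i.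
Hypothesis tmax_ge : forall i, tau i <= tmax.
Hypothesis tmax_gt0 : 0 < tmax.
Hypothesis G1_unit : 1%:M - G1 \in unitmx.
Local Notation M := (ros_matrix A B G1 G2).
Local Notation L := (invmx (1%:M - G1)).

Variables C nu1 : R.
Hypothesis C_gt0 : 0 < C.
Hypothesis nu1_gt0 : 0 < nu1.
Hypothesis ros_decay : forall z, ros_solution A B G1 G2 z -> forall t, 0 <= t ->
  enorm (z t) <= C * expR (- nu1 * t) * enorm (z 0).

Variables nu K2 : R.
Hypothesis nu_gt0 : 0 < nu.
Hypothesis nu_lt : nu < nu1.
Hypothesis K2_ge0 : 0 <= K2.
Hypothesis fundamental_sum : forall N j i,
  \sum_(d <- delays tau N | d < N%:R * tmin)
     `|fundamental tau G1 N j i d| * expR (nu * d) <= K2.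

Let zb := mxl1 (invmx M) * (n%:R + mxl1 B * mxl1 L * (m%:R * tmax)).
Let kd := zb + tmax + mxl1 L * (mxl1 G2 * zb + m%:R * tmax).

(** The primitives of z and of the trace solve the full system with constant
    inhomogeneities coming from z0 and y0. Subtracting the equilibrium (Zi, Ui) of this
    system gives a homogeneous continuous solution whose size is
    controlled by the L^1 norm of the data, and z is recovered as a linear
    combination of it, because z is the derivative of its primitive. *)
Lemma primitives_continuous_full eps (p : \bar R) (p1 : (1 <= p)%E) z0 y0 z y :
  0 < eps <= 1 -> in_space (Lebesgue_space p1) y0 ->
  full_solution lam A B G1 G2 eps (Lebesgue_space p1) z0 y0 z y ->
  exists X Q, continuous_full tau A B G1 G2 eps
      (kd * (enorm z0 + fine (space_norm (Lebesgue_space p1) y0))) X Q /\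
    forall t, 0 <= t -> z t = A *m X t + B *m Q t.
Proof.
move=> /andP[e0 e_1] y0s sol.
set ny := fine _.
have ny0 : 0 <= ny by apply: fine_ge0; exact: Lnorm_ge0.
pose Y : 'cV[R]_m := \col_i uint y (eps * tau i) i 0.
(* equilibrium: z0 + A Zi + B Ui = 0 and Ui = G1 Ui + G2 Zi + Y *)
pose Zi : 'cV[R]_n := - (invmx M *m (z0 + B *m (L *m Y))).
pose Ui : 'cV[R]_m := L *m (G2 *m Zi + Y).
have te0 i : 0 < eps * tau i by exact: mulr_gt0.
have te_le i : eps * tau i <= tmax.
  by apply: le_trans (tmax_ge i); rewrite ler_piMl // ltW.
have uinit t i : 0 <= t <= eps * tau i -> `|uint y t i 0| <= tmax * ny.
  move=> tI; apply: le_trans (uint_initial_le lam_gt0 e0 sol y0s tI) _.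
  by apply: ler_wpM2r => //; exact: te_le.
have Yb : mxl1 Y <= m%:R * (tmax * ny).
  by apply: mxl1_le_coord => i; rewrite mxE; apply: uinit; rewrite lexx ltW.
have UiE : Ui = G1 *m Ui + G2 *m Zi + Y.
  have e : (1%:M - G1) *m Ui = G2 *m Zi + Y by rewrite mulKVmx.
  by rewrite -addrA -e mulmxBl mul1mx addrC subrK.
have eq0 : z0 + (A *m Zi + B *m Ui) = 0.
  have MZ : M *m Zi = - (z0 + B *m (L *m Y)).
    by rewrite /Zi mulmxN mulKVmx //; apply: (ros_unitmx C_gt0 nu1_gt0 ros_decay).
  have -> : A *m Zi + B *m Ui = M *m Zi + B *m (L *m Y).
    by rewrite /ros_matrix mulmxDl /Ui !mulmxDr -!mulmxA addrA.
  by rewrite MZ opprD addrA addrA subrr add0r addNr.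
have M0 := mxl1_ge0 (invmx M); have B0 := mxl1_ge0 B; have L0 := mxl1_ge0 L.
have G0 := mxl1_ge0 G2.
set N0 := enorm z0 + ny.
have ez0 : 0 <= enorm z0 by exact: enorm_ge0.
have N00 : 0 <= N0 by exact: addr_ge0.
have mt0 : 0 <= m%:R * tmax by rewrite mulr_ge0 // ltW.
have Yb' : mxl1 Y <= m%:R * tmax * N0.
  apply: le_trans Yb _; rewrite mulrA ler_wpM2l // /N0 lerDr //.
have Zb : mxl1 Zi <= zb * N0.
  rewrite /Zi mxl1N; apply: le_trans (mxl1M _ _) _.
  rewrite /zb -mulrA ler_wpM2l //; apply: le_trans (mxl1D _ _) _.
  rewrite mulrDl; apply: lerD.
    apply: le_trans (mxl1_le_enorm _) _; rewrite ler_wpM2l // /N0 lerDl //.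
  apply: le_trans (mxl1M _ _) _; rewrite -!mulrA ler_wpM2l //.
  by apply: le_trans (mxl1M _ _) _; rewrite ler_wpM2l // mulrA.
have Ub : mxl1 Ui <= mxl1 L * (mxl1 G2 * zb + m%:R * tmax) * N0.
  apply: le_trans (mxl1M _ _) _; rewrite -mulrA ler_wpM2l //.
  apply: le_trans (mxl1D _ _) _; rewrite mulrDl; apply: lerD => //.
  by apply: le_trans (mxl1M _ _) _; rewrite -mulrA ler_wpM2l.
have zb0 : 0 <= zb by rewrite /zb mulr_ge0 // addr_ge0 // mulr_ge0 // mulr_ge0.
have lb0 : 0 <= mxl1 L * (mxl1 G2 * zb + m%:R * tmax).
  by rewrite mulr_ge0 // addr_ge0 // mulr_ge0.
have zE t : 0 <= t -> z t = A *m (zint z t - Zi) + B *m (uint y t - Ui).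
  move=> t0; rewrite (z_zint lam_gt0 e0 sol) // !mulmxBr addrACA -opprD addrC.
  by congr (_ + _); apply/eqP; rewrite -addr_eq0 eq0.
exists (fun t => zint z t - Zi), (fun t => uint y t - Ui); split=> //.
split.
- move=> T i; have -> : (fun t : R => (zint z t - Zi) i 0) = (fun t => zint z t i 0 - Zi i 0).
    by apply/funext => t; rewrite mxsubE.
  move=> x; apply: cvgB; last exact: cvg_cst.
  exact: (@zint_continuous _ _ _ _ _ _ _ _ _ _ _ _ _ _ _ sol).
- move=> T i; have -> : (fun t : R => (uint y t - Ui) i 0) = (fun t => uint y t i 0 - Ui i 0).
    by apply/funext => t; rewrite mxsubE.
  move=> x; apply: cvgB; last exact: cvg_cst.
  exact: (@uint_continuous _ _ _ _ _ _ _ _ lam_gt0 _ _ _ _ _ _ _ e0 sol).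
- move=> t i t0; rewrite -zE ?(ltW t0) //.
  have -> : (fun s : R => (zint z s - Zi) i 0) = (fun s => zint z s i 0 - Zi i 0).
    by apply/funext => s; rewrite mxsubE.
  have D := is_deriveB (zint_derive sol i t0) (is_derive_cst (Zi i 0) t (1 : R)).
  by rewrite subr0 in D.
- move=> t i ti; rewrite mxsubE (uint_delay lam_gt0 e0 sol) //.
  have oppE (P : 'cV[R]_m) : (- P) i 0 = - P i 0 by rewrite mxE.
  rewrite {1}UiE !mulmxBr !mxaddE !oppE [Y i 0]mxE; ring.
- rewrite (_ : zint z 0 = 0); last first.
    by apply/matrixP => i j; rewrite !mxE set_itv1 Rintegral_set1.
  rewrite sub0r mxl1N; apply: le_trans Zb _; rewrite ler_wpM2r // /kd -addrA lerDl.
  by rewrite addr_ge0 // ltW.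
- move=> t i /andP[t0 tt]; rewrite mxsubE; apply: le_trans (ler_normB _ _) _.
  have h1 : `|uint y t i 0| <= tmax * N0.
    apply: le_trans (uinit t i _) _; first by rewrite t0 ltW.
    by rewrite ler_wpM2l ?(ltW tmax_gt0) // lerDr.
  have h2 : `|Ui i 0| <= mxl1 L * (mxl1 G2 * zb + m%:R * tmax) * N0.
    exact: le_trans (le_mxl1 _ _ _) Ub.
  apply: le_trans (lerD h1 h2) _; rewrite -mulrDl ler_wpM2r // /kd.
  by rewrite -addrA lerDr.
Qed.

Theorem slow_decay : exists eps_star K : R, [/\ 0 < eps_star <= 1, 0 < K &
  forall eps (p : \bar R) (p1 : (1 <= p)%E) z0 y0 z y, 0 < eps <= eps_star ->
    in_space (Lebesgue_space p1) y0 ->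
    full_solution lam A B G1 G2 eps (Lebesgue_space p1) z0 y0 z y ->
    forall t, 0 <= t -> mxl1 (z t) <= K * expR (- nu * t) *
      (enorm z0 + fine (space_norm (Lebesgue_space p1) y0))].
Proof.
have [es [K [es0 K0 H]]] := small_gain tau_gt0 tmin_gt0 tmin_le tmax_ge tmax_gt0
  G1_unit C_gt0 ros_decay nu_gt0 nu_lt K2_ge0 fundamental_sum.
have AB0 : 0 <= mxl1 A + mxl1 B by rewrite addr_ge0 ?mxl1_ge0.
have kd0 : 0 <= kd.
  have M0 := mxl1_ge0 (invmx M); have B0 := mxl1_ge0 B; have L0 := mxl1_ge0 L.
  have G0 := mxl1_ge0 G2; have t0 := ltW tmax_gt0.
  have mt0 : 0 <= m%:R * tmax by rewrite mulr_ge0.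
  have zb0 : 0 <= zb by rewrite /zb mulr_ge0 // addr_ge0 // mulr_ge0 // mulr_ge0.
  rewrite /kd addr_ge0 //; first exact: addr_ge0.
  by apply: mulr_ge0 => //; apply: addr_ge0 => //; exact: mulr_ge0.
exists (Num.min es 1), ((mxl1 A + mxl1 B) * K * kd + 1); split.
- by rewrite lt_min es0 ltr01 ge_min lexx orbT.
- by rewrite ltr_wpDl // mulr_ge0 // mulr_ge0 // ltW.
move=> eps p p1 z0 y0 z y /andP[e0]; rewrite le_min => /andP[ees e_1] y0s sol t t0.
have eps01 : 0 < eps <= 1 by rewrite e0.
have [X [Q [cf zE]]] := primitives_continuous_full eps01 y0s sol.
have epss : 0 < eps <= es by rewrite e0.
have XQ := H _ _ _ _ epss cf t t0.
rewrite zE //; apply: le_trans (mxl1D _ _) _.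
apply: le_trans (lerD (mxl1M _ _) (mxl1M _ _)) _.
apply: (@le_trans _ _ ((mxl1 A + mxl1 B) * (mxl1 (X t) + mxl1 (Q t)))).
  rewrite mulrDl !mulrDr; have := mxl1_ge0 A; have := mxl1_ge0 B.
  have := mxl1_ge0 (X t); have := mxl1_ge0 (Q t).
  move=> q x b a; rewrite lerD // ?lerDl ?lerDr mulr_ge0 //.
apply: le_trans (_ : (mxl1 A + mxl1 B) * (K * expR (- nu * t) *
  (kd * (enorm z0 + fine (space_norm (Lebesgue_space p1) y0)))) <= _).
  by rewrite ler_wpM2l.
set N0 := enorm z0 + _.
have N00 : 0 <= N0.
  by rewrite addr_ge0 ?enorm_ge0 // fine_ge0 //; exact: Lnorm_ge0.
have -> : (mxl1 A + mxl1 B) * (K * expR (- nu * t) * (kd * N0)) =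
   (mxl1 A + mxl1 B) * K * kd * (expR (- nu * t) * N0) by ring.
rewrite -[leRHS]mulrA ler_wpM2r // ?mulr_ge0 ?expR_ge0 //.
by rewrite lerDl.
Qed.

End SlowDecay.

(** * Decay of the transported profile *)

Section FastDecay.
Variables (R : realType) (n m : nat) (lam : 'rV[R]_m).
Variables (A : 'M[R]_n) (B : 'M[R]_(n, m)) (G1 : 'M[R]_m) (G2 : 'M[R]_(m, n)).
Hypothesis lam_gt0 : forall i, 0 < lam 0 i.
Let tau i := (lam 0 i)^-1.
Let tau_gt0 i : 0 < tau i. Proof. by rewrite invr_gt0. Qed.
Variables tmin tmax : R.
Hypothesis tmin_gt0 : 0 < tmin.
Hypothesis tmin_le : forall i, tmin <= tau i.
Hypothesis tmax_ge : forall i, tau i <= tmax.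
Hypothesis tmax_gt0 : 0 < tmax.

Variables nu K2 Kz : R.
Hypothesis nu_gt0 : 0 < nu.
Hypothesis K2_ge0 : 0 <= K2.
Hypothesis Kz_ge0 : 0 <= Kz.
Hypothesis fundamental_sum : forall N j i,
  \sum_(d <- delays tau N | d < N%:R * tmin)
     `|fundamental tau G1 N j i d| * expR (nu * d) <= K2.

Local Notation I01 := (`]0, 1[%classic : set R).

Variables (eps : R) (p : \bar R) (p1 : (1 <= p)%E).
Variables (z0 : 'cV[R]_n) (y0 : R -> 'cV[R]_m) (z : R -> 'cV[R]_n) (y : R -> R -> 'cV[R]_m).
Hypothesis eps01 : 0 < eps <= 1.
Hypothesis y0_space : in_space (Lebesgue_space p1) y0.
Hypothesis sol : full_solution lam A B G1 G2 eps (Lebesgue_space p1) z0 y0 z y.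

Let N0 := enorm z0 + fine (space_norm (Lebesgue_space p1) y0).
Hypothesis z_decay : forall t, 0 <= t -> mxl1 (z t) <= Kz * expR (- nu * t) * N0.

Let eps_gt0 : 0 < eps. Proof. by case/andP: eps01. Qed.
Let eps_le1 : eps <= 1. Proof. by case/andP: eps01. Qed.

Let uh i s := trace y i (eps * s).
Let g i s := uh i s - delay_op tau G1 uh i s.

Lemma uh_le0 i s : s <= 0 -> uh i s = 0.
Proof. by move=> s0; rewrite /uh /trace pmulr_rle0 // s0. Qed.

Lemma forcing_lt0 i s : s <= 0 -> g i s = 0.
Proof.
move=> s0; rewrite /g uh_le0 // /delay_op big1 ?subr0 // => j _.
by rewrite uh_le0 ?mulr0 //; have := tau_gt0 i; lra.
Qed.

Lemma forcing_data i s : 0 < s < tau i -> g i s = y0 (1 - s / tau i) i 0.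
Proof.
move=> /andP[s0 st]; rewrite /g /delay_op big1 ?subr0; last first.
  by move=> j _; rewrite uh_le0 ?mulr0 //; lra.
rewrite /uh (trace_data lam_gt0 eps_gt0 sol) ?mulr_gt0 // ?ltr_pM2l //.
congr (y0 _ _ _); rewrite -/(tau i); field; rewrite !gt_eqF //.
Qed.

Lemma forcing_slow i s : tau i < s -> `|g i s| <= mxl1 G2 * (Kz * expR (- nu * (eps * (s - tau i))) * N0).
Proof.
move=> ts; have -> : g i s = (G2 *m z (eps * (s - tau i))) i 0.
  have dE : delay_op tau G1 uh i s = \sum_j G1 i j * trace y j (eps * s - eps * tau i).
    by apply: eq_bigr => j _; rewrite /uh mulrBr.
  rewrite /g dE {1}/uh (trace_delay lam_gt0 eps_gt0 sol) ?ltr_pM2l //.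
  by rewrite addrAC subrr add0r [RHS]mxE; apply: eq_bigr => k _; rewrite mulrBr.
apply: le_trans (le_mxl1 _ _ _) _; apply: le_trans (mxl1M _ _) _.
rewrite ler_wpM2l ?mxl1_ge0 //; apply: z_decay.
by rewrite mulr_ge0 ?(ltW eps_gt0) // subr_ge0 ltW.
Qed.

Lemma uh_measurable i : measurable_fun setT (uh i).
Proof.
apply: (measurableT_comp (trace_measurable lam_gt0 eps_gt0 sol i)).
exact: measurable_funM.
Qed.

Lemma forcing_measurable i : measurable_fun setT (g i).
Proof.
apply: measurable_funB; first exact: uh_measurable.
apply: measurable_sum => j; apply: measurable_funM => //.
apply: (measurableT_comp (uh_measurable j)).
exact: measurable_funB.
Qed.

Lemma window_measurable (f : R -> R) (a b : R) : measurable_fun setT f ->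
  measurable_fun I01 (fun x => f (b - a * x)).
Proof.
move=> mf; apply: measurable_funTS; apply: (measurableT_comp mf).
by apply: measurable_funB => //; exact: measurable_funM.
Qed.

Let E2 := expR (2 * nu * tmax).
Let R0 := E2 * (1 + mxl1 G2 * Kz) * N0.

Let ny_ge0 : 0 <= fine (space_norm (Lebesgue_space p1) y0).
Proof. by apply: fine_ge0; exact: Lnorm_ge0. Qed.

Let N0_ge0 : 0 <= N0. Proof. by rewrite addr_ge0 // enorm_ge0. Qed.

Let expE (sigma : R) : sigma <= 2 * tmax -> 1 <= E2 * expR (- (nu * eps) * sigma).
Proof.
move=> h; rewrite /E2 -expRD -[leLHS]expR0 ler_expR.
have h1 : nu * eps * sigma <= nu * (2 * tmax).
  have [s0|s0] := ltP sigma 0.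
    apply: (@le_trans _ _ 0); last by rewrite !mulr_ge0 // ltW.
    by rewrite mulr_ge0_le0 ?mulr_ge0 // ltW.
  rewrite -mulrA ler_wpM2l ?(ltW nu_gt0) //; apply: le_trans h.
  by rewrite ler_piMl.
by lra.
Qed.

(** For s < tau j the forcing is the initial profile (f1), after s = tau j it is
    G2 z, which is bounded pointwise. The single time s = tau j is a null set. *)
Lemma forcing_window j sigma : 0 <= sigma ->
  (lnorm p (fun x => g j (sigma - tmax * x)) <= (R0 * expR (- (nu * eps) * sigma))%:E)%E.
Proof.
move=> s0; set e := expR _.
have e0 : 0 <= e by exact: expR_ge0.
have tj := tau_gt0 j.
have tn : tau j != 0 by rewrite gt_eqF.
have my0 : measurable_fun I01 (fun x => y0 x j 0) by exact: y0_space.1.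
pose a := tmax / tau j; pose b := 1 - sigma / tau j.
have abE x : a * x + b = 1 - (sigma - tmax * x) / tau j by rewrite /a /b; field.
have abI x : (a * x + b \in I01) = (0 < sigma - tmax * x < tau j).
  rewrite abE; set s := sigma - _; apply/idP/idP.
    rewrite inE /= in_itv /= => /andP[h1 h2].
    have q1 : 0 < s / tau j by lra.
    have q2 : s / tau j < 1 by lra.
    by move: q1 q2; rewrite ltr_pdivrMr // mul1r pmulr_lgt0 ?invr_gt0 // => -> ->.
  move=> /andP[h1 h2]; rewrite inE /= in_itv /=.
  have q1 : 0 < s / tau j by rewrite divr_gt0.
  have q2 : s / tau j < 1 by rewrite ltr_pdivrMr // mul1r.
  by apply/andP; split; lra.
pose f1 x := ((fun x => y0 x j 0) \_ I01) (a * x + b).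
have mf1 : measurable_fun I01 f1.
  apply: measurable_funTS; apply: (measurableT_comp (measurable_patch01 my0)).
  exact: measurable_affine.
have mg : measurable_fun I01 (fun x => g j (sigma - tmax * x)).
  by apply: window_measurable; exact: forcing_measurable.
have L1 : (lnorm p f1 <= (E2 * N0 * e)%:E)%E.
  have [sl|sb] := leP sigma (2 * tmax).
    apply: (@le_trans _ _ (fine (space_norm (Lebesgue_space p1) y0))%:E); last first.
      rewrite lee_fin mulrAC; apply: le_trans (_ : N0 <= _); first by rewrite lerDr enorm_ge0.
      by rewrite ler_peMl //; exact: expE.
    rewrite fineK; last first.
      by rewrite ge0_fin_numE; [exact: y0_space.2 | exact: Lnorm_ge0].
    apply: le_trans (lnorm_coord_le p1 j y0_space.1).
    have a0 : a != 0 by rewrite mulf_neq0 ?invr_eq0 // gt_eqF.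
    apply: le_trans (@lnorm_le_affine _ p f1 (fun x => y0 x j 0) a b 0 p1 a0 mf1 my0 _) _.
      move=> x _ _; rewrite /f1 patchE; case: ifPn; last by rewrite eqxx.
      by rewrite inE /= in_itv.
    rewrite (_ : Num.max _ _ = 1) ?mul1e //; apply/max_idPl.
    rewrite gtr0_norm ?divr_gt0 // invf_div ler_pdivrMr // mul1r; exact: tmax_ge.
  apply: lnorm_le_cst => // x /andP[x0 x1].
  rewrite /f1 patchE abI ifF ?normr0; first by rewrite !mulr_ge0 ?expR_ge0.
  apply/negbTE; rewrite negb_and -!leNgt; apply/orP; right.
  by have := tmax_ge j; have : tmax * x <= tmax; [rewrite ler_piMr // ltW | lra].
pose cst2 := E2 * (mxl1 G2 * Kz) * N0 * e.
have c20 : 0 <= cst2 by rewrite /cst2 !mulr_ge0 ?expR_ge0 ?mxl1_ge0.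
have L2 : (lnorm p (fun x => g j (sigma - tmax * x) - f1 x)%R <= cst2%:E)%E.
  apply: le_trans (@lnorm_le_affine _ p _ (fun=> cst2) 1 0 ((sigma - tau j) / tmax) p1
    (oner_neq0 R) _ _ _) _.
  - exact: measurable_funB.
  - exact: measurable_cst.
  - move=> x x01 xx _; rewrite mul1r addr0 x01; split => //.
    rewrite (ger0_norm c20) /f1 patchE abI abE; set s := sigma - tmax * x.
    case: ifPn => [sI|]; first by rewrite forcing_data // subrr normr0.
    have sn : s != tau j.
      apply: contra xx => /eqP sE; apply/eqP.
      by apply: (mulIf (gt_eqF tmax_gt0 : tmax != 0 :> R) _) || (rewrite -sE /s; field; rewrite gt_eqF).
    rewrite subr0 negb_and -!leNgt => /orP[sneg|ts]; first by rewrite forcing_lt0 // normr0.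
    have {}ts : tau j < s by rewrite lt_def sn.
    apply: le_trans (forcing_slow ts) _; rewrite /cst2.
    have : expR (- nu * (eps * (s - tau j))) <= E2 * e.
      rewrite /E2 /e -expRD ler_expR.
      have : sigma - 2 * tmax <= s - tau j.
        have [x0 x1] := andP x01; have := tmax_ge j.
        have : tmax * x <= tmax; [by rewrite ler_piMr // ltW | rewrite /s; lra].
      move=> h; have h2 : nu * eps * (sigma - 2 * tmax) <= nu * eps * (s - tau j).
        by rewrite ler_wpM2l // mulr_ge0 // ltW.
      have h3 : nu * eps * (2 * tmax) <= nu * (2 * tmax).
        rewrite -mulrA ler_wpM2l ?(ltW nu_gt0) // ler_piMl // mulr_ge0 // ltW //.
      by lra.
    move=> h; rewrite (_ : E2 * _ * N0 * e = mxl1 G2 * (Kz * (E2 * e) * N0)); last by ring.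
    by rewrite ler_wpM2l ?mxl1_ge0 // ler_wpM2r // ler_wpM2l.
  rewrite normr1 invr1 maxxx mul1e; apply: lnorm_le_cst => // x _.
  by rewrite ger0_norm.
have gE : (fun x => g j (sigma - tmax * x)) =
    (fun x => f1 x + (g j (sigma - tmax * x) - f1 x)).
  by apply/funext => x; rewrite [RHS]addrC subrK.
rewrite gE; apply: le_trans (lnormD_le p1 mf1 _) _; first exact: measurable_funB.
apply: le_trans (leeD L1 L2) _; rewrite -EFinD lee_fin /R0 /cst2.
by rewrite le_eqVlt; apply/orP; left; apply/eqP; ring.
Qed.

(** The convolution formula turns into the triangle inequality: translations in
    time act on windows of fixed length tmax without any change of variables. *)
Lemma trace_lnorm_window i sigma : 0 <= sigma ->
  (lnorm p (fun x => uh i (sigma - tmax * x)) <=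
   (m%:R * K2 * R0 * expR (- (nu * eps) * sigma))%:E)%E.
Proof.
move=> s0; have [N sN] := archi_bound_mul sigma tmin_gt0.
have u0 l s : s < 0 -> uh l s = 0 by move=> ?; rewrite uh_le0 // ltW.
have ug l s : uh l s = g l s + delay_op tau G1 uh l s by rewrite /g subrK.
pose F (j : 'I_m) d x := fundamental tau G1 N j i d * g j ((sigma - d) - tmax * x).
have mF j d : measurable_fun I01 (F j d).
  by apply: measurable_funM => //; apply: window_measurable; exact: forcing_measurable.
have R00 : 0 <= R0.
  by rewrite /R0 !mulr_ge0 ?expR_ge0 // addr_ge0 // mulr_ge0 ?mxl1_ge0.
apply: (@le_trans _ _ (lnorm p (fun x => \sum_j \sum_(d <- delays tau N | d <= sigma) F j d x)%R)).
  rewrite le_eqVlt; apply/orP; left; apply/eqP.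
  apply: eq_Lnorm => x; rewrite !patchE; case: ifPn => //.
  rewrite inE /= in_itv /= => /andP[x0 x1]; congr EFin.
  have tx : 0 < tmax * x by exact: mulr_gt0.
  rewrite (delay_equation_conv (tau:=tau) (G:=G1) tau_gt0 tmin_le i u0 ug (N:=N)); last by lra.
  apply: eq_bigr => j _; rewrite big_mkcond [RHS]big_mkcond; apply: eq_bigr => d _.
  case: ifPn => [ds|]; first by rewrite ifT /F; [congr (_ * g j _); ring | lra].
  rewrite -ltNge => sd; case: ifP => // _.
  by rewrite /F forcing_lt0 ?mulr0 //; lra.
rewrite (_ : m%:R * K2 * R0 * _ = \sum_(j < m) K2 * R0 * expR (- (nu * eps) * sigma)); last first.
  by rewrite sumr_const card_ord -[RHS]mulr_natl !mulrA.
apply: lnorm_sum_le => // j _ _; split.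
  rewrite (_ : (fun x => _) = (fun x => \sum_(d <- delays tau N) (if d <= sigma then F j d x else 0))).
    by apply: measurable_sum => d; case: (d <= sigma).
  by apply/funext => x; rewrite big_mkcond.
apply: (@le_trans _ _ (\sum_(d <- delays tau N | d <= sigma)
    `|fundamental tau G1 N j i d| * (R0 * expR (- (nu * eps) * (sigma - d))))%:E).
  apply: lnorm_sum_le => // d _ ds; split => //.
  apply: le_trans (lnormZ_le _ p1 _) _.
    by apply: window_measurable; exact: forcing_measurable.
  rewrite EFinM; apply: lee_wpmul2l => //.
  by apply: forcing_window; rewrite subr_ge0.
rewrite lee_fin; apply: le_trans (_ : (\sum_(d <- delays tau N | d < N%:R * tmin)
    `|fundamental tau G1 N j i d| * expR (nu * eps * d)) * (R0 * expR (- (nu * eps) * sigma)) <= _).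
  rewrite mulr_suml big_mkcond [leRHS]big_mkcond; apply: ler_sum => d _.
  case: ifPn => [ds|_]; last first.
    by case: ifP => // _; apply: mulr_ge0; apply: mulr_ge0 => //; exact: expR_ge0.
  rewrite (le_lt_trans ds sN) -mulrA ler_wpM2l // mulrCA ler_wpM2l // -expRD ler_expR.
  by lra.
rewrite -[leRHS]mulrA; apply: ler_wpM2r.
  by apply: mulr_ge0 => //; exact: expR_ge0.
exact: (fundamental_sum_eps tmin_gt0 tmin_le nu_gt0 fundamental_sum).
Qed.

(** Component i of the profile at time t is a piece of length tau i of the trace,
    seen through the window of length tmax. *)
Lemma profile_decay t : 0 <= t ->
  (space_norm (Lebesgue_space p1) (y ^~ t) <=
   (m%:R * (tmax / tmin * (m%:R * K2 * (E2 * (1 + mxl1 G2 * Kz)))) *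
    expR (- nu * t) * N0)%:E)%E.
Proof.
move=> t0; have mt i : measurable_fun I01 (fun x => y x t i 0).
  by exact: (full_in_space sol t0).1.
have R00 : 0 <= R0.
  by rewrite /R0 !mulr_ge0 ?expR_ge0 // addr_ge0 // mulr_ge0 ?mxl1_ge0.
pose bnd := tmax / tmin * (m%:R * K2 * R0 * expR (- nu * t)).
have Q0 : 0 <= m%:R * K2 * R0 by apply: mulr_ge0 => //; exact: mulr_ge0.
apply: (@le_trans _ _ (\sum_(i < m) bnd)%:E); last first.
  rewrite lee_fin sumr_const card_ord -[leLHS]mulr_natl /bnd /R0.
  by rewrite le_eqVlt; apply/orP; left; apply/eqP; ring.
apply: space_norm_le_sum => // i.
have ti := tau_gt0 i; pose sigma := t / eps + tau i.
have te0 : 0 <= t / eps by rewrite divr_ge0 // ltW.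
have s0 : 0 <= sigma by rewrite addr_ge0 // ltW.
have a0 : 0 < tau i / tmax by exact: divr_gt0.
have mw : measurable_fun I01 (fun x => uh i (sigma - tmax * x)).
  by apply: window_measurable; exact: uh_measurable.
apply: le_trans (@lnorm_le_affine _ p _ (fun x => uh i (sigma - tmax * x)) (tau i / tmax) 0 0
  p1 _ (mt i) mw _) _; first by rewrite gt_eqF.
  move=> x /andP[x0 x1] _ _; rewrite addr0; split.
    rewrite mulr_gt0 //= mulrAC ltr_pdivrMr // mul1r.
    by apply: lt_le_trans (tmax_ge i); rewrite -[ltRHS]mulr1 ltr_pM2l.
  rewrite (traceE lam_gt0 eps_gt0 sol) ?(ltW x0) // /uh.
  rewrite (_ : eps * (sigma - tmax * (tau i / tmax * x)) =
    t + eps * (lam 0 i)^-1 * (1 - x)) //.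
  by rewrite /sigma -/(tau i); field; rewrite !gt_eqF.
apply: (@le_trans _ _ ((tmax / tmin)%:E * (m%:R * K2 * R0 * expR (- nu * t))%:E)%E); last by [].
have ttm : 0 <= tmax / tmin by rewrite divr_ge0 // ltW.
apply: lee_pmul => //.
- exact: lnorm_ge0.
- rewrite lee_fin ge_max; apply/andP; split.
    by rewrite ler_pdivlMr // mul1r; exact: le_trans (tmin_le i) (tmax_ge i).
  by rewrite gtr0_norm // invf_div ler_wpM2l ?(ltW tmax_gt0) // lef_pV2 ?posrE.
apply: le_trans (trace_lnorm_window i s0) _; rewrite lee_fin ler_wpM2l // ler_expR.
have -> : - (nu * eps) * sigma = - nu * t - nu * eps * tau i.
  by rewrite /sigma; field; rewrite gt_eqF.
by rewrite gerBl !mulr_ge0 // ltW.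
Qed.

End FastDecay.

(** * Exponential stability of the full system *)

Lemma full_solution_Lebesgue (R : realType) (n m : nat) (lam : 'rV[R]_m) (A : 'M[R]_n)
    (B : 'M[R]_(n, m)) (G1 : 'M[R]_m) (G2 : 'M[R]_(m, n)) (eps : R)
    (p : \bar R) (p1 : (1 <= p)%E) z0 y0 z y :
  full_solution lam A B G1 G2 eps Continuous_space z0 y0 z y ->
  full_solution lam A B G1 G2 eps (Lebesgue_space p1) z0 y0 z y.
Proof.
by case=> h1 h2 h3 h4 h5; split => // t t0; apply: continuous_in_Lebesgue; exact: h5.
Qed.

Theorem mainTheorem1 (R : realType) (n m : nat)
    (lam : 'rV[R]_m) (A : 'M[R]_n) (B : 'M[R]_(n, m))
    (G1 : 'M[R]_m) (G2 : 'M[R]_(m, n)) :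
  (0 < n)%N -> (0 < m)%N ->
  (forall i, 0 < lam 0 i) ->
  1%:M - G1 \in unitmx ->
  ros_exp_stable A B G1 G2 ->
  (exists S : data_space R, bls_exp_stable lam G1 S) ->
  exists eps_star : R, 0 < eps_star /\
    forall eps : R, 0 < eps <= eps_star ->
    forall S : data_space R, full_exp_stable lam A B G1 G2 eps S.
Proof.
move=> _ m_gt0 lam_gt0 G1_unit [C [nu1 [C0 nu10 ros_decay]]] [S0 bls].
pose tau i := (lam 0 i)^-1.
have tau_gt0 i : 0 < tau i by rewrite invr_gt0.
(* crude bounds of the delays, positive because m > 0 *)
pose tmin := (\sum_i lam 0 i)^-1; pose tmax := \sum_i tau i.
have le_sum (f : 'I_m -> R) i : (forall j, 0 < f j) -> f i <= \sum_j f j.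
  by move=> f0; rewrite (bigD1 i) //= lerDl sumr_ge0 // => j _; exact: ltW.
have lam_sum : 0 < \sum_i lam 0 i.
  exact: lt_le_trans (lam_gt0 (Ordinal m_gt0)) (le_sum _ _ _).
have tmin_gt0 : 0 < tmin by rewrite invr_gt0.
have tmin_le i : tmin <= tau i by rewrite lef_pV2 ?posrE //; exact: le_sum.
have tmax_ge i : tau i <= tmax by exact: le_sum.
have tmax_gt0 : 0 < tmax by apply: lt_le_trans (tmax_ge (Ordinal m_gt0)).
have [C2 [nu2 [_ nu20 decay]]] := bls_fundamental_decay lam_gt0 tmin_gt0 tmin_le tmax_ge bls.
pose nu := Num.min nu1 nu2 / 2.
have min_gt0 : 0 < Num.min nu1 nu2 by rewrite lt_min nu10.
have nu_gt0 : 0 < nu by exact: divr_gt0.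
have nu_min : nu < Num.min nu1 nu2 by rewrite /nu ltr_pdivrMr // ltr_pMr // ltr1n.
have [nu_lt1 nu_lt2] : nu < nu1 /\ nu < nu2 by move: nu_min; rewrite lt_min => /andP[].
have [K HK] := sum_fundamental_le tau_gt0 tmin_gt0 nu_lt2 decay.
pose K2 := Num.max 0 K.
have K2_ge0 : 0 <= K2 by rewrite le_max lexx.
have HK2 N j i : \sum_(d <- delays tau N | d < N%:R * tmin)
    `|fundamental tau G1 N j i d| * expR (nu * d) <= K2.
  by apply: le_trans (HK N j i) _; rewrite le_max lexx orbT.
have [es [Kz [/andP[es0 es1] Kz0 slow]]] := slow_decay lam_gt0 tmin_gt0 tmin_le tmax_ge
  tmax_gt0 G1_unit C0 nu10 ros_decay nu_gt0 nu_lt1 K2_ge0 HK2.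
exists es; split=> // eps /andP[eps0 eps_es].
pose Ky := m%:R * (tmax / tmin * (m%:R * K2 * (expR (2 * nu * tmax) * (1 + mxl1 G2 * Kz)))).
have Ky0 : 0 <= Ky.
  rewrite /Ky mulr_ge0 // mulr_ge0 //; first by rewrite divr_ge0 // ltW.
  rewrite mulr_ge0 ?mulr_ge0 ?expR_ge0 // addr_ge0 // mulr_ge0 ?mxl1_ge0 //; exact: ltW.
have eps01 : 0 < eps <= 1 by rewrite eps0 (le_trans eps_es).
have epsI : 0 < eps <= es by rewrite eps0.
have Leb (p : \bar R) (p1 : (1 <= p)%E) z0 y0 z y : in_space (Lebesgue_space p1) y0 ->
    full_solution lam A B G1 G2 eps (Lebesgue_space p1) z0 y0 z y -> forall t, 0 <= t ->
    ((enorm (z t))%:E + space_norm (Lebesgue_space p1) (y ^~ t) <=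
     ((Kz + Ky) * expR (- nu * t))%:E *
       ((enorm z0)%:E + space_norm (Lebesgue_space p1) y0))%E.
  move=> y0s sol t t0.
  have zd := slow eps p p1 z0 y0 z y epsI y0s sol.
  have yd := profile_decay lam_gt0 tmin_gt0 tmin_le tmax_ge tmax_gt0 nu_gt0 K2_ge0
    (ltW Kz0) HK2 eps01 y0s sol zd t0.
  have Nfin : space_norm (Lebesgue_space p1) y0 \is a fin_num.
    by rewrite ge0_fin_numE; [exact: y0s.2 | exact: Lnorm_ge0].
  apply: (le_trans (leeD (_ : (enorm (z t))%:E <= (Kz * expR (- nu * t) *
    (enorm z0 + fine (space_norm (Lebesgue_space p1) y0)))%:E)%E yd)).
    by rewrite lee_fin; apply: le_trans (enorm_le_mxl1 _) (zd t t0).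
  rewrite -[in leRHS](fineK Nfin) -!EFinD -EFinM lee_fin.
  by rewrite -/Ky !mulrDl.
have KK0 : 0 < Kz + Ky by rewrite ltr_wpDr.
case=> [p p1|]; exists (Kz + Ky), nu; split => //.
  by move=> z0 y0 z y [y0s _] sol; exact: Leb.
have oo1 : (1 <= +oo :> \bar R)%E by rewrite leey.
move=> z0 y0 z y [y0s _] sol t t0.
have [y0L <-] := continuous_space_norm oo1 y0s.
have [_ <-] := continuous_space_norm oo1 (full_in_space sol t0).
by apply: Leb => //; exact: full_solution_Lebesgue.
Qed.
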